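(* Let $k$ be a field of characteristic zero. If $L$ is an affine Kac-Moody Lie algebra over $k$ with no infinite dimensional abelian quotients and $L_0$ is its positive part, then for $*\in\{\le,\triangleleft\}$, $\mathcal X^*(L_0)$ and $\mathcal X_0^*(L)$ are stable classes of subalgebras.
   Context: **Affine Kac-Moody algebras.** Let $\mathfrak g=\mathfrak g_1\oplus\dots\oplus\mathfrak g_q$ be a decomposition into simple finite dimensional Lie algebras over $k$; for each $i$ let $\alpha_i$ be an automorphism of $\mathfrak g_i$ of finite order $m_i$ (possibly trivial), where $k$ contains a primitive $m_i$-th root of unity $\varepsilon_i$. Write $\mathfrak g_i=\bigoplus_{j\in\mathbb Z/m_i}\mathfrak g_{i,j}$, $\mathfrak g_{i,j}$ the eigenspace of $\alpha_i$ for $\varepsilon_i^j$. The (twisted) polynomial loop algebra is $L_{(\alpha_i)}\mathfrak g_i=\bigoplus_{n\in\mathbb Z}\mathfrak g_{i,\,n\bmod m_i}\otimes t^n$. The associated affine Kac-Moody algebra is $$L=\bigoplus_{i=1}^q\bigl(L_{(\alpha_i)}\mathfrak g_i\oplus k\,c_i\oplus k\,d_i\bigr),$$ where $c_i$ is central, $L_{(\alpha_i)}\mathfrak g_i\oplus kc_i$ is the central extension $[a t^p,bt^r]=[a,b]t^{p+r}+p\,\delta_{p,-r}\kappa_i(a,b)c_i$ ($\kappa_i$ the Killing form of $\mathfrak g_i$), and $d_i$ acts as the derivation $t\frac{d}{dt}$. $L$ is $\mathbb Z$-graded by powers of $t$ ($c_i,d_i$ in degree $0$), $L=\bigoplus_n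 L(n)$, and is filtered by $L_j=\bigoplus_{n\ge j}L(n)$, $j\in\mathbb Z$. The positive part is $L_0$, which is $\mathbb N$-filtered by $(L_j)_{j\ge0}$. **Filtered Lie algebras.** $(A,B)$ denotes the span of brackets. An $\mathbb N$-filtered Lie algebra $L$ has subspaces $L=L_0\supset L_1\supset\cdots$ of finite codimension with $(L_i,L_j)\subset L_{i+j}$, $\bigcap L_i=0$. A $\mathbb Z$-filtered Lie algebra has a decreasing filtration by subspaces $L_j$ ($j\in\mathbb Z$), $(L_i,L_j)\subset L_{i+j}$, all $L_j$ commensurable with $L_0$, $\bigcup L_j=L$, $\bigcap L_j=0$. For $K/k$ a finite extension, $L\otimes K$ is filtered by $L_j\otimes K$. A subspace $H$ is closed if $H=\bigcap_j(H+L_j\otimes K)$. $H$ is commensurable with $L_0\otimes K$ if $H\cap(L_0\otimes K)$ has finite codimension in $H$ and in $L_0\otimes K$; its codimension in $L_0\otimes K$ is then the sum of these two codimensions. **Classes of subalgebras.** A class $\mathcal X$ of subalgebras of $L$ is a family $\mathcal X(K)$ of subalgebras of $L\otimes K$ for every finite extension $K$ of $k$. $\mathcal X^{\le}(L)(K)$ is the set of all closed subalgebras of $L\otimes K$, $\mathcal X^{\triangleleft}(L)(K)$ the set of those that are ideals of $L\otimes K$. For $L$ $\mathbb Z$-filtered, $\mathcal X_0^*(L)(K)$ is the set of members of $\mathcal X^*(L)(K)$ commensurable with $L_0\otimes K$. $A_n(\mathcal X)(K)$ is the set of $H\in\mathcal X(K)$ of codimension $n$ (in $L\otimes K$ in the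 $\mathbb N$-filtered case; in $L_0\otimes K$ in the $\mathbb Z$-filtered commensurable case, where the codimension of $H$ in $L_0\otimes K$ means the sum of the codimension of $H\cap(L_0\otimes K)$ in $H$ and its codimension in $L_0\otimes K$), and $A_{l,n}(\mathcal X)(K)=\{H\in A_n(\mathcal X)(K): H\supseteq L_l\otimes K\}$. Let $X_l$ be the variety $\mathrm{Gr}(L/L_l)$ (resp. $\mathrm{Gr}(L_{-l}/L_l)$ in the $\mathbb Z$-filtered case) of all linear subspaces of the given finite dimensional space. $\mathcal X$ is *constructible* if for all $l,n\in\mathbb N$ the members of $A_{l,n}(\mathcal X)(K)$ ($K$ varying; in the $\mathbb Z$-filtered case, those contained in $L_{-l}\otimes K$) form the set of $K$-points of a constructible subset of $X_l$. $\mathcal X$ is *stable* if it is constructible and for every $n$ there is $l$ such that $A_{l,n}(\mathcal X)(K)=A_{j,n}(\mathcal X)(K)$ for all $j\ge l$ and all $K$. *)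

(* Defs.v *)
From HB Require Import structures.
From mathcomp Require Import all_boot all_order all_algebra all_field.
From mathcomp Require Import finmap mpoly.
Set Implicit Arguments.
Unset Strict Implicit.
Unset Printing Implicit Defensive.
Import GRing.Theory.
Local Open Scope ring_scope.

HB.mixin Record Lmodule_isLie (k : fieldType) L of GRing.Lmodule k L := {
  lie : L -> L -> L;
  lie_linearl : forall y, linear (lie^~ y);
  lie_linearr : forall x, linear (lie x);
  liexx : forall x, lie x x = 0;
  lie_jacobi : forall x y z,
    lie x (lie y z) + lie y (lie z x) + lie z (lie x y) = 0
}.

#[short(type="lieType")]
HB.structure Definition Lie (k : fieldType) :=
  {L of GRing.Lmodule k L & Lmodule_isLie k L}.

#[short(type="fdLieType")]
HB.structure Definition FdLie (k : fieldType) :=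
  {L of Lie k L & Vector k L}.

Section LieTheory.
Variables (k : fieldType) (L : lieType k).
Implicit Types x y z : L.

HB.instance Definition _ x :=
  GRing.isLinear.Build k L L *:%R (lie x) (lie_linearr x).

Lemma lieDl x y z : lie (x + y) z = lie x z + lie y z.
Proof. by have := lie_linearl z 1 x y; rewrite !scale1r. Qed.
Lemma lie0l z : lie 0 z = 0 :> L.
Proof. by apply: (addrI (lie 0 z)); rewrite -lieDl !addr0. Qed.
Lemma lieZl a x z : lie (a *: x) z = a *: lie x z.
Proof. by have := lie_linearl z a x 0; rewrite lie0l !addr0. Qed.
Lemma lieNl x z : lie (- x) z = - lie x z.
Proof. by rewrite -scaleN1r lieZl scaleN1r. Qed.
Lemma lieDr x y z : lie x (y + z) = lie x y + lie x z.
Proof. exact: linearD. Qed.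
Lemma lieZr a x z : lie x (a *: z) = a *: lie x z.
Proof. exact: linearZ. Qed.
Lemma lie0r x : lie x 0 = 0 :> L.
Proof. exact: linear0. Qed.
Lemma lieC x y : lie x y = - lie y x.
Proof.
apply/eqP; rewrite -addr_eq0; have := liexx (x + y).
by rewrite lieDl !lieDr !liexx add0r addr0 => ->.
Qed.
Lemma lie_suml I (r : seq I) (P : pred I) F z :
  lie (\sum_(i <- r | P i) F i) z = \sum_(i <- r | P i) lie (F i) z.
Proof.
elim/big_rec2: _ => [|i _ y _ <-]; first exact: lie0l.
by rewrite lieDl.
Qed.
Lemma lie_sumr I (r : seq I) (P : pred I) F z :
  lie z (\sum_(i <- r | P i) F i) = \sum_(i <- r | P i) lie z (F i).
Proof. exact: linear_sum. Qed.

End LieTheory.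

Section Product.
Variables (k : fieldType) (I : finType) (A : I -> lieType k).

Definition lprod : Type := {dffun forall i, A i}.
HB.instance Definition _ := Choice.on lprod.
Implicit Types x y z : lprod.

Definition lprod_mk (F : forall i, A i) : lprod := [ffun i => F i].
Definition lprod_at x i : A i := x i.
Lemma lprodE F i : lprod_at (lprod_mk F) i = F i.
Proof. exact: ffunE. Qed.
Lemma lprodP x y : (forall i, lprod_at x i = lprod_at y i) -> x = y.
Proof. by move=> e; apply/ffunP. Qed.

Definition lprod_add x y := lprod_mk (fun i => lprod_at x i + lprod_at y i).
Definition lprod_opp x := lprod_mk (fun i => - lprod_at x i).
Definition lprod_0 := lprod_mk (fun i => 0).
Fact lprod_addA : associative lprod_add.
Proof. by move=> x y z; apply: lprodP => i; rewrite !lprodE addrA. Qed.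
Fact lprod_addC : commutative lprod_add.
Proof. by move=> x y; apply: lprodP => i; rewrite !lprodE addrC. Qed.
Fact lprod_add0 : left_id lprod_0 lprod_add.
Proof. by move=> x; apply: lprodP => i; rewrite !lprodE add0r. Qed.
Fact lprod_addN : left_inverse lprod_0 lprod_opp lprod_add.
Proof. by move=> x; apply: lprodP => i; rewrite !lprodE addNr. Qed.
HB.instance Definition _ :=
  GRing.isZmodule.Build lprod lprod_addA lprod_addC lprod_add0 lprod_addN.

Definition lprod_scale (a : k) x := lprod_mk (fun i => a *: lprod_at x i).
Fact lprod_scaleA a b x :
  lprod_scale a (lprod_scale b x) = lprod_scale (a * b) x.
Proof. by apply: lprodP => i; rewrite !lprodE scalerA. Qed.
Fact lprod_scale1 : left_id 1 lprod_scale.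
Proof. by move=> x; apply: lprodP => i; rewrite !lprodE scale1r. Qed.
Fact lprod_scaleDr : right_distributive lprod_scale +%R.
Proof. by move=> a x y; apply: lprodP => i; rewrite !lprodE scalerDr. Qed.
Fact lprod_scaleDl x : {morph lprod_scale^~ x : a b / a + b}.
Proof. by move=> a b; apply: lprodP => i; rewrite !lprodE scalerDl. Qed.
HB.instance Definition _ := GRing.Zmodule_isLmodule.Build k lprod
  lprod_scaleA lprod_scale1 lprod_scaleDr lprod_scaleDl.

Definition lprod_lie x y := lprod_mk (fun i => lie (lprod_at x i) (lprod_at y i)).
Fact lprod_linl y : linear (lprod_lie^~ y).
Proof. by move=> a x z; apply: lprodP => i; rewrite !lprodE lieDl lieZl. Qed.
Fact lprod_linr x : linear (lprod_lie x).
Proof. by move=> a y z; apply: lprodP => i; rewrite !lprodE lieDr lieZr. Qed.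
Fact lprod_liexx x : lprod_lie x x = 0.
Proof. by apply: lprodP => i; rewrite !lprodE liexx. Qed.
Fact lprod_jacobi x y z : lprod_lie x (lprod_lie y z) +
  lprod_lie y (lprod_lie z x) + lprod_lie z (lprod_lie x y) = 0.
Proof. by apply: lprodP => i; rewrite !lprodE lie_jacobi. Qed.
HB.instance Definition _ := Lmodule_isLie.Build k lprod
  lprod_linl lprod_linr lprod_liexx lprod_jacobi.

End Product.

(* The tensor product L (x)_k K, encoded by coordinates along the chosen
   k-basis e = vbasis {:K} of K: x stands for \sum_i x i (x) e_i. *)
Section BaseChange.
Variables (k : fieldType) (L : lieType k) (K : fieldExtType k).
Local Notation n := (\dim {:K}).
Local Notation e := (vbasis {:K}).

Definition tens : Type := {ffun 'I_n -> L}.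
HB.instance Definition _ := GRing.Zmodule.on tens.
Implicit Types (x y z : tens) (a b : K).

Definition tens_scale a x : tens :=
  [ffun j => \sum_(i < n) coord e j (a * e`_i) *: x i].

Lemma tens_coord (a : K) : a = \sum_(i < n) coord e i a *: e`_i.
Proof. exact: coord_vbasis (memvf a). Qed.

Lemma tens_coordM a b l :
  coord e l (a * b) = \sum_(i < n) coord e l (a * e`_i) * coord e i b.
Proof.
rewrite {1}[b]tens_coord mulr_sumr linear_sum; apply: eq_bigr => i _.
by rewrite -scalerAr linearZ /= mulrC.
Qed.

Fact tens_scaleA a b x : tens_scale a (tens_scale b x) = tens_scale (a * b) x.
Proof.
apply/ffunP => l; rewrite !ffunE.
under eq_bigr do rewrite ffunE scaler_sumr.
rewrite exchange_big; apply: eq_bigr => i _ /=.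
rewrite -mulrA tens_coordM scaler_suml; apply: eq_bigr => j _.
by rewrite scalerA.
Qed.
Fact tens_scale1 : left_id 1 tens_scale.
Proof.
move=> x; apply/ffunP => l; rewrite ffunE (bigD1 l) //= mul1r.
have fe := basis_free (vbasisP {:K}).
rewrite coord_free // eqxx scale1r big1 ?addr0 // => i /negPf ne.
by rewrite mul1r coord_free // eq_sym -val_eqE /= eq_sym [_ == _]ne scale0r.
Qed.
Fact tens_scaleDr : right_distributive tens_scale +%R.
Proof.
move=> a x y; apply/ffunP => l; rewrite !ffunE -big_split.
by apply: eq_bigr => i _; rewrite !ffunE scalerDr.
Qed.
Fact tens_scaleDl x : {morph tens_scale^~ x : a b / a + b}.
Proof.
move=> a b; apply/ffunP => l; rewrite !ffunE -big_split.
by apply: eq_bigr => i _; rewrite mulrDl linearD scalerDl.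
Qed.
HB.instance Definition _ := GRing.Zmodule_isLmodule.Build K tens
  tens_scaleA tens_scale1 tens_scaleDr tens_scaleDl.

Definition tens_lie x y : tens :=
  [ffun l => \sum_(i < n) \sum_(j < n) coord e l (e`_i * e`_j) *: lie (x i) (y j)].

Fact tens_linr x : linear (tens_lie x).
Proof.
move=> a y z; apply/ffunP => l; rewrite !ffunE.
pose T := \sum_(i < n) \sum_(h < n) \sum_(j < n)
  (coord e l (e`_i * e`_j) * coord e j (a * e`_h)) *: lie (x i) (y h).
transitivity (T + tens_lie x z l).
  rewrite ffunE -big_split; apply: eq_bigr => i _ /=.
  rewrite exchange_big -big_split; apply: eq_bigr => j _ /=.
  rewrite !ffunE lieDr scalerDr lie_sumr scaler_sumr; congr (_ + _).
  by apply: eq_bigr => h _; rewrite lieZr scalerA.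
congr (_ + _); last by rewrite ffunE.
rewrite /T; under [RHS]eq_bigr do rewrite ffunE scaler_sumr.
rewrite [RHS]exchange_big; apply: eq_bigr => i _ /=.
under [RHS]eq_bigr do rewrite scaler_sumr.
rewrite [RHS]exchange_big; apply: eq_bigr => h _ /=.
rewrite -scaler_suml -tens_coordM.
under [RHS]eq_bigr do rewrite scalerA.
by rewrite -scaler_suml -tens_coordM mulrCA.
Qed.

Fact tens_liexx x : tens_lie x x = 0.
Proof.
apply/ffunP => l; rewrite !ffunE.
pose F (i j : 'I_n) := coord e l (e`_i * e`_j) *: lie (x i) (x j).
have Fii i : F i i = 0 by rewrite /F liexx scaler0.
have FC i j : F i j = - F j i by rewrite /F lieC scalerN mulrC.
rewrite pair_big /= (bigID (fun p : 'I_n * 'I_n => p.1 < p.2)%N) /=.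
rewrite [X in _ + X](bigID (fun p : 'I_n * 'I_n => p.1 == p.2)) /=.
rewrite [X in _ + (X + _)]big1 ?add0r; last first.
  by case=> i j /= /andP[_ /eqP->]; exact: Fii.
rewrite (reindex (fun p : 'I_n * 'I_n => (p.2, p.1))) /=; last first.
  by exists (fun p : 'I_n * 'I_n => (p.2, p.1)) => -[].
rewrite (eq_bigl (fun p : 'I_n * 'I_n => ~~ (p.1 < p.2)%N && (p.1 != p.2))).
  rewrite -big_split big1 //= => -[i j] _ /=.
  by rewrite -/(F j i) -/(F i j) FC addNr.
by case=> i j /=; rewrite -leqNgt ltn_neqAle andbC -val_eqE eq_sym.
Qed.

Lemma tens_lieC x y : tens_lie x y = - tens_lie y x.
Proof.
apply/ffunP => l; rewrite !ffunE exchange_big -sumrN; apply: eq_bigr => i _.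
rewrite -sumrN; apply: eq_bigr => j _.
by rewrite lieC scalerN mulrC.
Qed.
Fact tens_linl y : linear (tens_lie^~ y).
Proof.
move=> a x z; rewrite tens_lieC tens_linr opprD -scalerN.
by rewrite -!tens_lieC.
Qed.

Lemma tens_lie3 x y z l : tens_lie x (tens_lie y z) l =
  \sum_(i < n) \sum_(j < n) \sum_(h < n)
    coord e l (e`_i * (e`_j * e`_h)) *: lie (x i) (lie (y j) (z h)).
Proof.
rewrite ffunE; apply: eq_bigr => i _.
under eq_bigr do rewrite ffunE lie_sumr scaler_sumr.
rewrite exchange_big; apply: eq_bigr => j _ /=.
under eq_bigr do rewrite lie_sumr scaler_sumr.
rewrite exchange_big; apply: eq_bigr => h _ /=.
under eq_bigr do rewrite lieZr scalerA.
by rewrite -scaler_suml -tens_coordM.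
Qed.

Fact tens_jacobi x y z : tens_lie x (tens_lie y z) +
  tens_lie y (tens_lie z x) + tens_lie z (tens_lie x y) = 0.
Proof.
apply/ffunP => l.
transitivity (tens_lie x (tens_lie y z) l + tens_lie y (tens_lie z x) l +
              tens_lie z (tens_lie x y) l); first by rewrite !ffunE.
have rot (G : 'I_n -> 'I_n -> 'I_n -> L) :
  \sum_i \sum_j \sum_h G i j h = \sum_h \sum_i \sum_j G i j h.
  rewrite [RHS]exchange_big; apply: eq_bigr => i _ /=.
  by rewrite [RHS]exchange_big.
rewrite !tens_lie3 [X in _ + X + _]rot [X in _ + X](rot) [X in _ + X]rot.
rewrite -!big_split big1 ?ffunE // => i _.
rewrite -!big_split big1 // => j _; rewrite -!big_split big1 // => h _ /=.
have -> : e`_j * (e`_h * e`_i) = e`_i * (e`_j * e`_h).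
  by rewrite mulrA mulrC.
have -> : e`_h * (e`_i * e`_j) = e`_i * (e`_j * e`_h).
  by rewrite mulrC mulrA.
by rewrite -!scalerDr lie_jacobi scaler0.
Qed.
HB.instance Definition _ := Lmodule_isLie.Build K tens
  tens_linl tens_linr tens_liexx tens_jacobi.

End BaseChange.

Section Killing.
Variables (k : fieldType) (g : fdLieType k).
Local Notation e := (vbasis {:g}).

Definition ad (a : g) : 'End(g) := linfun (lie a).
Lemma adE a b : ad a b = lie a b. Proof. by rewrite lfunE. Qed.
Definition lf_trace (f : 'End(g)) : k := \tr (passmx.mxof e e f).
Definition killing (a b : g) : k := lf_trace (ad a \o ad b)%VF.

Fact lf_trace_linear : linear (lf_trace : 'End(g) -> k^o).
Proof. by move=> a f h; rewrite /lf_trace passmx.mxof_linear linearP. Qed.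
HB.instance Definition _ :=
  GRing.isLinear.Build k 'End(g) k^o *:%R lf_trace lf_trace_linear.
Lemma lf_traceC f h : lf_trace (f \o h)%VF = lf_trace (h \o f)%VF.
Proof.
rewrite /lf_trace !(passmx.mxof_comp e e (vbasisP {:g})).
exact: mxtrace_mulC.
Qed.

Lemma killingC a b : killing a b = killing b a.
Proof. exact: lf_traceC. Qed.
Lemma killing_linl b : linear (killing^~ b : g -> k^o).
Proof.
move=> s a c; rewrite /killing -linearP; congr lf_trace; apply/lfunP => x.
by rewrite !(comp_lfunE, add_lfunE, scale_lfunE) !adE lieDl lieZl.
Qed.
Lemma killingDl a b c : killing (a + b) c = killing a c + killing b c.
Proof. by have := killing_linl c 1 a b; rewrite !scale1r. Qed.
Lemma killing0l c : killing 0 c = 0.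
Proof. by apply: (addrI (killing 0 c)); rewrite -killingDl !addr0. Qed.
Lemma killingZl s a c : killing (s *: a) c = s * killing a c.
Proof. by have := killing_linl c s a 0; rewrite killing0l !addr0. Qed.
Lemma killing0r c : killing c 0 = 0.
Proof. by rewrite killingC killing0l. Qed.
Lemma killingDr a b c : killing a (b + c) = killing a b + killing a c.
Proof. by rewrite !(killingC a) killingDl. Qed.
Lemma killingZr s a c : killing a (s *: c) = s * killing a c.
Proof. by rewrite !(killingC a) killingZl. Qed.

Lemma ad_lie a b : ad (lie a b) = ((ad a \o ad b) - (ad b \o ad a))%VF.
Proof.
apply/lfunP => x; rewrite !(add_lfunE, opp_lfunE, comp_lfunE) !adE.
rewrite (lieC _ x) (lieC a x) linearN opprK.
by apply/esym/eqP; rewrite -addr_eq0 lie_jacobi.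
Qed.

Lemma killing_inv a b c : killing (lie a b) c = killing a (lie b c).
Proof.
rewrite /killing !ad_lie.
have -> : (((ad a \o ad b) - (ad b \o ad a)) \o ad c =
  (ad a \o (ad b \o ad c)) - (ad b \o (ad a \o ad c)))%VF.
  by rewrite comp_lfunDl comp_lfunNl !comp_lfunA.
have -> : (ad a \o ((ad b \o ad c) - (ad c \o ad b)) =
  (ad a \o (ad b \o ad c)) - ((ad a \o ad c) \o ad b))%VF.
  by rewrite comp_lfunDr comp_lfunNr !comp_lfunA.
by rewrite !linearB /= (lf_traceC (ad b)).
Qed.

End Killing.

(* g (x) k[t, 1/t]: f stands for \sum_n f n t^n *)
Section Loop.
Variables (k : fieldType) (g : fdLieType k).

Definition loop : Type := {fsfun int -> g with 0}.
HB.instance Definition _ := Choice.on loop.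
Implicit Types f h u : loop.
Definition loop_at f (n : int) : g := f n.
Definition loop_mk (S : {fset int}) (F : int -> g) : loop :=
  [fsfun n in S => F n | 0].

Lemma loop_mkE (S : {fset int}) F :
  (forall n, n \notin S -> F n = 0) -> forall n, loop_at (loop_mk S F) n = F n.
Proof. by move=> F0 n; rewrite /loop_at fsfunE; case: ifPn => // /F0. Qed.
Lemma loop_dflt f n : n \notin finsupp f -> loop_at f n = 0.
Proof. exact: fsfun_dflt. Qed.
Lemma loopP f h : (forall n, loop_at f n = loop_at h n) -> f = h.
Proof. by move=> e; apply/fsfunP. Qed.

Definition loop_0 : loop := loop_mk fset0 (fun=> 0).
Definition loop_add f h : loop :=
  loop_mk (finsupp f `|` finsupp h)%fset (fun n => loop_at f n + loop_at h n).
Definition loop_opp f : loop := loop_mk (finsupp f) (fun n => - loop_at f n).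
Definition loop_scale (a : k) f : loop :=
  loop_mk (finsupp f) (fun n => a *: loop_at f n).

Lemma loop_0E n : loop_at loop_0 n = 0.
Proof. exact: loop_mkE. Qed.
Lemma loop_addE f h n : loop_at (loop_add f h) n = loop_at f n + loop_at h n.
Proof.
apply: loop_mkE => m; rewrite in_fsetU negb_or => /andP[mf mh].
by rewrite !loop_dflt ?addr0.
Qed.
Lemma loop_oppE f n : loop_at (loop_opp f) n = - loop_at f n.
Proof. by apply: loop_mkE => m mf; rewrite loop_dflt ?oppr0. Qed.
Lemma loop_scaleE a f n : loop_at (loop_scale a f) n = a *: loop_at f n.
Proof. by apply: loop_mkE => m mf; rewrite loop_dflt ?scaler0. Qed.

Fact loop_addA : associative loop_add.
Proof. by move=> f h u; apply: loopP => n; rewrite !loop_addE addrA. Qed.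
Fact loop_addC : commutative loop_add.
Proof. by move=> f h; apply: loopP => n; rewrite !loop_addE addrC. Qed.
Fact loop_add0 : left_id loop_0 loop_add.
Proof. by move=> f; apply: loopP => n; rewrite loop_addE loop_0E add0r. Qed.
Fact loop_addN : left_inverse loop_0 loop_opp loop_add.
Proof.
by move=> f; apply: loopP => n; rewrite loop_addE loop_0E loop_oppE addNr.
Qed.
HB.instance Definition _ :=
  GRing.isZmodule.Build loop loop_addA loop_addC loop_add0 loop_addN.
Fact loop_scaleA a b f : loop_scale a (loop_scale b f) = loop_scale (a * b) f.
Proof. by apply: loopP => n; rewrite !loop_scaleE scalerA. Qed.
Fact loop_scale1 : left_id 1 loop_scale.
Proof. by move=> f; apply: loopP => n; rewrite loop_scaleE scale1r. Qed.
Fact loop_scaleDr : right_distributive loop_scale +%R.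
Proof.
by move=> a f h; apply: loopP => n; rewrite !(loop_scaleE, loop_addE) scalerDr.
Qed.
Fact loop_scaleDl f : {morph loop_scale^~ f : a b / a + b}.
Proof.
by move=> a b; apply: loopP => n; rewrite !(loop_scaleE, loop_addE) scalerDl.
Qed.
HB.instance Definition _ := GRing.Zmodule_isLmodule.Build k loop
  loop_scaleA loop_scale1 loop_scaleDr loop_scaleDl.

Lemma loopE0 n : loop_at 0 n = 0. Proof. exact: loop_0E. Qed.
Lemma loopED f h n : loop_at (f + h) n = loop_at f n + loop_at h n.
Proof. exact: loop_addE. Qed.
Lemma loopEN f n : loop_at (- f) n = - loop_at f n.
Proof. exact: loop_oppE. Qed.
Lemma loopEZ a f n : loop_at (a *: f) n = a *: loop_at f n.
Proof. exact: loop_scaleE. Qed.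
Lemma loopE_sum I (r : seq I) (F : I -> loop) n :
  loop_at (\sum_(i <- r) F i) n = \sum_(i <- r) loop_at (F i) n.
Proof.
by elim/big_rec2: _ => [|i _ y _ <-]; rewrite ?loopE0 ?loopED.
Qed.

(* a t^p *)
Definition mono (p : int) (a : g) : loop :=
  loop_mk [fset p]%fset (fun n => if n == p then a else 0).
Lemma monoE p a n : loop_at (mono p a) n = if n == p then a else 0.
Proof. by apply: loop_mkE => m; rewrite in_fset1 => /negPf ->. Qed.

Lemma loop_sum f : f = \sum_(p <- finsupp f) mono p (loop_at f p).
Proof.
apply: loopP => n; rewrite loopE_sum.
have [nf|nf] := boolP (n \in finsupp f).
  rewrite (big_fsetD1 n) //= monoE eqxx big_seq big1 ?addr0 // => p.
  by rewrite !inE => /andP[np _]; rewrite monoE eq_sym (negPf np).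
rewrite loop_dflt // big_seq big1 // => p pf; rewrite monoE.
by case: eqP => // np; rewrite np pf in nf.
Qed.

Lemma loop_ind (P : loop -> Prop) :
  P 0 -> (forall f h, P f -> P h -> P (f + h)) ->
  (forall p a, P (mono p a)) -> forall f, P f.
Proof. by move=> P0 PD Pm f; rewrite [f]loop_sum; apply: big_ind. Qed.

Definition loop_lie f h : loop :=
  loop_mk [fset (p + r)%R | p in finsupp f, r in finsupp h]%fset
    (fun n => \sum_(p <- finsupp f) lie (loop_at f p) (loop_at h (n - p))).
(* t d/dt *)
Definition loop_der f : loop :=
  loop_mk (finsupp f) (fun n => n%:~R *: loop_at f n).
(* bilinear, with (a t^p, b t^r) |-> p \delta_{p,-r} \kappa(a, b) *)
Definition loop_cocycle f h : k :=
  \sum_(p <- finsupp f) p%:~R * killing (loop_at f p) (loop_at h (- p)).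

Lemma sum_finsupp (V : nmodType) f (S : {fset int}) (G : int -> g -> V) :
  (forall p, G p 0 = 0) -> (finsupp f `<=` S)%fset ->
  \sum_(p <- finsupp f) G p (loop_at f p) = \sum_(p <- S) G p (loop_at f p).
Proof.
move=> G0 fS; rewrite (big_fset_incl _ fS) // => p _ pf.
by rewrite loop_dflt.
Qed.

Lemma loop_lieE f h n : loop_at (loop_lie f h) n =
  \sum_(p <- finsupp f) lie (loop_at f p) (loop_at h (n - p)).
Proof.
apply: loop_mkE => m mS; rewrite big_seq big1 // => p pf.
rewrite (@loop_dflt h) ?lie0r //; apply: contra mS => mh.
by apply/imfset2P; exists p => //; exists (m - p) => //; rewrite addrC subrK.
Qed.
Lemma loop_derE f n : loop_at (loop_der f) n = n%:~R *: loop_at f n.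
Proof. by apply: loop_mkE => m mf; rewrite loop_dflt ?scaler0. Qed.

Lemma loop_sum_lin (V : lmodType k) (G : int -> g -> V) a f h :
  (forall p, linear (G p)) ->
  \sum_(p <- finsupp (a *: f + h)) G p (loop_at (a *: f + h) p) =
  a *: \sum_(p <- finsupp f) G p (loop_at f p) +
  \sum_(p <- finsupp h) G p (loop_at h p).
Proof.
move=> linG.
have G0 p : G p 0 = 0.
  by have /eqP := linG p 1 0 0; rewrite !scale1r addr0 -subr_eq0 opprD
    addrA subrr sub0r oppr_eq0 => /eqP.
pose S := (finsupp (a *: f + h)%R `|` finsupp f `|` finsupp h)%fset.
rewrite !(sum_finsupp (S := S)) //; first last.
- by rewrite /S -fsetUA fsubsetUl.
- by rewrite /S fsetUAC fsubsetUr.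
- by rewrite /S fsubsetUr.
rewrite scaler_sumr -big_split; apply: eq_bigr => p _ /=.
by rewrite loopED loopEZ linG.
Qed.

Fact loop_linl h : linear (loop_lie^~ h).
Proof.
move=> a f u; apply: loopP => n; rewrite loopED loopEZ !loop_lieE.
rewrite (loop_sum_lin (G := fun p x => lie x (loop_at h (n - p)))) // => p.
exact: lie_linearl.
Qed.
Fact loop_linr f : linear (loop_lie f).
Proof.
move=> a h u; apply: loopP => n; rewrite loopED loopEZ !loop_lieE.
rewrite scaler_sumr -big_split; apply: eq_bigr => p _ /=.
by rewrite loopED loopEZ lieDr lieZr.
Qed.
Lemma cocycle_linl h : linear (loop_cocycle^~ h : loop -> k^o).
Proof.
move=> a f u.
pose G (p : int) (x : g) : k^o := p%:~R * killing x (loop_at h (- p)).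
apply: (loop_sum_lin (G := G)) => p s x y.
by rewrite /G killingDl killingZl mulrDr mulrCA.
Qed.
Lemma cocycle_linr f : linear (loop_cocycle f : loop -> k^o).
Proof.
move=> a h u; rewrite /loop_cocycle scaler_sumr -big_split.
apply: eq_bigr => p _ /=.
by rewrite loopED loopEZ killingDr killingZr mulrDr mulrCA.
Qed.
Lemma loop_der_lin : linear loop_der.
Proof.
move=> a f h; apply: loopP => n; rewrite !(loop_derE, loopED, loopEZ).
by rewrite scalerDr !scalerA mulrC.
Qed.

Lemma sum_mono (V : nmodType) (G : int -> g -> V) p a :
  (forall q, G q 0 = 0) ->
  \sum_(q <- finsupp (mono p a)) G q (loop_at (mono p a) q) = G p a.
Proof.
move=> G0; rewrite (sum_finsupp (S := [fset p]%fset)) //.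
  by rewrite big_seq_fset1 monoE eqxx.
apply/fsubsetP => q; rewrite mem_finsupp in_fset1 -/(loop_at _ q) monoE.
by case: ifP => //; rewrite eqxx.
Qed.

Lemma loop_lie_mono p a r b :
  loop_lie (mono p a) (mono r b) = mono (p + r) (lie a b).
Proof.
apply: loopP => n; rewrite loop_lieE.
rewrite (sum_mono (G := fun q x => lie x (loop_at (mono r b) (n - q)))).
  by rewrite !monoE subr_eq addrC; case: ifP => // _; rewrite lie0r.
by move=> q; rewrite lie0l.
Qed.
Lemma cocycle_mono p a r b :
  loop_cocycle (mono p a) (mono r b) =
    if p == - r then p%:~R * killing a b else 0.
Proof.
rewrite /loop_cocycle
  (sum_mono (G := fun q x => q%:~R * killing x (loop_at (mono r b) (- q)))).
  by rewrite monoE eqr_oppLR; case: ifP => // _; rewrite killing0r mulr0.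
by move=> q; rewrite killing0l mulr0.
Qed.
Lemma loop_der_mono p a : loop_der (mono p a) = p%:~R *: mono p a.
Proof.
apply: loopP => n; rewrite loop_derE loopEZ !monoE.
by case: eqP => [->//|_]; rewrite !scaler0.
Qed.


Lemma loop_lieDl f h u : loop_lie (f + h) u = loop_lie f u + loop_lie h u.
Proof. by have := loop_linl u 1 f h; rewrite !scale1r. Qed.
Lemma loop_lieDr f h u : loop_lie u (f + h) = loop_lie u f + loop_lie u h.
Proof. by have := loop_linr u 1 f h; rewrite !scale1r. Qed.
Lemma loop_lie0l u : loop_lie 0 u = 0.
Proof. by apply: (addrI (loop_lie 0 u)); rewrite -loop_lieDl !addr0. Qed.
Lemma loop_lie0r u : loop_lie u 0 = 0.
Proof. by apply: (addrI (loop_lie u 0)); rewrite -loop_lieDr !addr0. Qed.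
Lemma loop_lieZl a f u : loop_lie (a *: f) u = a *: loop_lie f u.
Proof. by have := loop_linl u a f 0; rewrite loop_lie0l !addr0. Qed.
Lemma loop_lieZr a f u : loop_lie u (a *: f) = a *: loop_lie u f.
Proof. by have := loop_linr u a f 0; rewrite loop_lie0r !addr0. Qed.
Lemma loop_derD f h : loop_der (f + h) = loop_der f + loop_der h.
Proof. by have := loop_der_lin 1 f h; rewrite !scale1r. Qed.
Lemma loop_der0 : loop_der 0 = 0.
Proof. by apply: (addrI (loop_der 0)); rewrite -loop_derD !addr0. Qed.
Lemma loop_derZ a f : loop_der (a *: f) = a *: loop_der f.
Proof. by have := loop_der_lin a f 0; rewrite loop_der0 !addr0. Qed.
Lemma cocycleDl f h u :
  loop_cocycle (f + h) u = loop_cocycle f u + loop_cocycle h u.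
Proof. by have := cocycle_linl u 1 f h; rewrite !scale1r. Qed.
Lemma cocycleDr f h u :
  loop_cocycle u (f + h) = loop_cocycle u f + loop_cocycle u h.
Proof. by have := cocycle_linr u 1 f h; rewrite !scale1r. Qed.
Lemma cocycle0l u : loop_cocycle 0 u = 0.
Proof. by apply: (addrI (loop_cocycle 0 u)); rewrite -cocycleDl !addr0. Qed.
Lemma cocycle0r u : loop_cocycle u 0 = 0.
Proof. by apply: (addrI (loop_cocycle u 0)); rewrite -cocycleDr !addr0. Qed.
Lemma cocycleZl a f u : loop_cocycle (a *: f) u = a * loop_cocycle f u.
Proof. by have := cocycle_linl u a f 0; rewrite cocycle0l !addr0. Qed.
Lemma cocycleZr a f u : loop_cocycle u (a *: f) = a * loop_cocycle u f.
Proof. by have := cocycle_linr u a f 0; rewrite cocycle0r !addr0. Qed.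

Lemma monoD p a b : mono p (a + b) = mono p a + mono p b.
Proof.
by apply: loopP => n; rewrite loopED !monoE; case: ifP; rewrite ?addr0.
Qed.
Lemma mono0 p : mono p 0 = 0.
Proof. by apply: loopP => n; rewrite loopE0 monoE if_same. Qed.

Lemma loop_lieC f h : loop_lie f h = - loop_lie h f.
Proof.
apply/eqP; rewrite -addr_eq0; apply/eqP; move: h.
elim/loop_ind: f => [h|f1 f2 IH1 IH2 h|p a].
- by rewrite loop_lie0l loop_lie0r addr0.
- by rewrite loop_lieDl loop_lieDr addrACA IH1 IH2 addr0.
elim/loop_ind => [|h1 h2 IH1 IH2|r b].
- by rewrite loop_lie0l loop_lie0r addr0.
- by rewrite loop_lieDl loop_lieDr addrACA IH1 IH2 addr0.
by rewrite !loop_lie_mono (addrC r) -monoD [lie b a]lieC subrr mono0.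
Qed.
Lemma loop_liexx f : loop_lie f f = 0.
Proof.
elim/loop_ind: f => [|f1 f2 IH1 IH2|p a].
- exact: loop_lie0l.
- rewrite loop_lieDl !loop_lieDr IH1 IH2 add0r addr0.
  by rewrite [X in _ + X]loop_lieC subrr.
by rewrite loop_lie_mono liexx mono0.
Qed.

Lemma cocycleC f h : loop_cocycle f h = - loop_cocycle h f.
Proof.
apply/eqP; rewrite -addr_eq0; apply/eqP; move: h.
elim/loop_ind: f => [h|f1 f2 IH1 IH2 h|p a].
- by rewrite cocycle0l cocycle0r addr0.
- by rewrite cocycleDl cocycleDr addrACA IH1 IH2 addr0.
elim/loop_ind => [|h1 h2 IH1 IH2|r b].
- by rewrite cocycle0l cocycle0r addr0.
- by rewrite cocycleDl cocycleDr addrACA IH1 IH2 addr0.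
rewrite !cocycle_mono; case: (eqVneq p (- r)) => [->|ne].
  rewrite opprK eqxx killingC -mulrDl -intrD addNr mul0r //.
by rewrite -eqr_oppLR eq_sym (negPf ne) addr0.
Qed.
Lemma cocyclexx f : loop_cocycle f f = 0.
Proof.
elim/loop_ind: f => [|f1 f2 IH1 IH2|p a].
- exact: cocycle0l.
- rewrite cocycleDl !cocycleDr IH1 IH2 add0r addr0.
  by rewrite [X in _ + X]cocycleC subrr.
rewrite cocycle_mono; case: eqP => // pp.
suff -> : p = 0 by rewrite mul0r.
by case: p pp => [[|n]|n].
Qed.

Lemma trilin0 (V : zmodType) (T : loop -> loop -> loop -> V) :
  (forall f h u v, T (f + h) u v = T f u v + T h u v) ->
  (forall f h u v, T u (f + h) v = T u f v + T u h v) ->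
  (forall f h u v, T u v (f + h) = T u v f + T u v h) ->
  (forall p r s a b c, T (mono p a) (mono r b) (mono s c) = 0) ->
  forall f h u, T f h u = 0.
Proof.
move=> T1 T2 T3 T0.
elim/loop_ind => [h u|f1 f2 IH1 IH2 h u|p a].
- by apply: (addrI (T 0 h u)); rewrite -T1 !addr0.
- by rewrite T1 IH1 IH2 addr0.
elim/loop_ind => [u|f1 f2 IH1 IH2 u|r b].
- by apply: (addrI (T (mono p a) 0 u)); rewrite -T2 !addr0.
- by rewrite T2 IH1 IH2 addr0.
elim/loop_ind => [|f1 f2 IH1 IH2|s c //].
- by apply: (addrI (T (mono p a) (mono r b) 0)); rewrite -T3 !addr0.
- by rewrite T3 IH1 IH2 addr0.
Qed.

Lemma add3ACA (V : zmodType) (a b c a' b' c' : V) :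
  (a + a') + (b + b') + (c + c') = (a + b + c) + (a' + b' + c').
Proof. by rewrite (addrACA a) (addrACA (a + b)). Qed.

Lemma loop_jacobi f h u : loop_lie f (loop_lie h u) +
  loop_lie h (loop_lie u f) + loop_lie u (loop_lie f h) = 0.
Proof.
move: f h u; apply: (trilin0 (T := fun f h u => loop_lie f (loop_lie h u) +
  loop_lie h (loop_lie u f) + loop_lie u (loop_lie f h))).
- by move=> *; rewrite !(loop_lieDl, loop_lieDr) add3ACA.
- by move=> *; rewrite !(loop_lieDl, loop_lieDr) add3ACA.
- by move=> *; rewrite !(loop_lieDl, loop_lieDr) add3ACA.
move=> p r s a b c; rewrite !loop_lie_mono.
have -> : r + (s + p) = p + (r + s) by rewrite addrA addrC.
have -> : s + (p + r) = p + (r + s) by rewrite addrC -addrA.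
by rewrite -!monoD lie_jacobi mono0.
Qed.

Lemma cocycle_jacobi f h u : loop_cocycle f (loop_lie h u) +
  loop_cocycle h (loop_lie u f) + loop_cocycle u (loop_lie f h) = 0.
Proof.
move: f h u; apply: (trilin0 (T := fun f h u => loop_cocycle f (loop_lie h u) +
  loop_cocycle h (loop_lie u f) + loop_cocycle u (loop_lie f h))).
- by move=> *; rewrite !(loop_lieDl, loop_lieDr, cocycleDl, cocycleDr) add3ACA.
- by move=> *; rewrite !(loop_lieDl, loop_lieDr, cocycleDl, cocycleDr) add3ACA.
- by move=> *; rewrite !(loop_lieDl, loop_lieDr, cocycleDl, cocycleDr) add3ACA.
move=> p r s a b c; rewrite !loop_lie_mono !cocycle_mono.
rewrite -!addr_eq0.
have -> : r + (s + p) = p + (r + s) by rewrite addrA addrC.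
have -> : s + (p + r) = p + (r + s) by rewrite addrC -addrA.
case: eqP => [prs|_]; last by rewrite !addr0.
rewrite -(killing_inv b) (killingC _ a) (killingC c) killing_inv.
by rewrite -!mulrDl -!intrD -addrA prs mul0r.
Qed.

Lemma loop_der_lie f h :
  loop_der (loop_lie f h) = loop_lie (loop_der f) h + loop_lie f (loop_der h).
Proof.
move: h; elim/loop_ind: f => [h|f1 f2 IH1 IH2 h|p a].
- by rewrite !(loop_lie0l, loop_der0) addr0.
- by rewrite loop_derD !loop_lieDl loop_derD IH1 IH2 addrACA.
elim/loop_ind => [|h1 h2 IH1 IH2|r b].
- by rewrite !(loop_lie0r, loop_der0) addr0.
- by rewrite loop_derD !loop_lieDr loop_derD IH1 IH2 addrACA.
rewrite !(loop_der_mono, loop_lie_mono, loop_lieZl, loop_lieZr).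
by rewrite -scalerDl -intrD.
Qed.

Lemma cocycle_der f h :
  loop_cocycle (loop_der f) h + loop_cocycle f (loop_der h) = 0.
Proof.
move: h; elim/loop_ind: f => [h|f1 f2 IH1 IH2 h|p a].
- by rewrite loop_der0 !cocycle0l addr0.
- by rewrite loop_derD !cocycleDl addrACA IH1 IH2 addr0.
elim/loop_ind => [|h1 h2 IH1 IH2|r b].
- by rewrite loop_der0 !cocycle0r addr0.
- by rewrite loop_derD !cocycleDr addrACA IH1 IH2 addr0.
rewrite !loop_der_mono cocycleZl cocycleZr cocycle_mono -mulrDl -intrD.
by case: eqP => [->|_]; rewrite ?addNr ?mul0r ?mulr0.
Qed.

End Loop.

(* The untwisted algebra g (x) k[t, 1/t] + k c + k d: triples of a loop and the
   coefficients of c and d *)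
Section Affine.
Variables (k : fieldType) (g : fdLieType k).

Definition aff : Type := (loop g * k^o * k^o)%type.
HB.instance Definition _ := GRing.Lmodule.on aff.
Implicit Types x y z : aff.
Definition aff_loop x : loop g := x.1.1.
Definition aff_c x : k := x.1.2.
Definition aff_d x : k := x.2.

Definition aff_lie x y : aff :=
  (loop_lie (aff_loop x) (aff_loop y)
     + (aff_d x *: loop_der (aff_loop y) - aff_d y *: loop_der (aff_loop x)),
   loop_cocycle (aff_loop x) (aff_loop y), 0).

Fact aff_liexx x : aff_lie x x = 0.
Proof. by rewrite /aff_lie loop_liexx cocyclexx subrr addr0. Qed.
Lemma affP x y : aff_loop x = aff_loop y -> aff_c x = aff_c y ->
  aff_d x = aff_d y -> x = y.
Proof.
by case: x y => [[f a] b] [[f' a'] b'] /= ef ea eb; congr (_, _, _).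
Qed.
Lemma aff_loopP a x y : aff_loop (a *: x + y) = a *: aff_loop x + aff_loop y.
Proof. by []. Qed.
Lemma aff_loopD x y : aff_loop (x + y) = aff_loop x + aff_loop y.
Proof. by []. Qed.
Lemma aff_cP a x y : aff_c (a *: x + y) = a * aff_c x + aff_c y.
Proof. by []. Qed.
Lemma aff_cD x y : aff_c (x + y) = aff_c x + aff_c y.
Proof. by []. Qed.
Lemma aff_dP a x y : aff_d (a *: x + y) = a * aff_d x + aff_d y.
Proof. by []. Qed.
Lemma aff_dD x y : aff_d (x + y) = aff_d x + aff_d y.
Proof. by []. Qed.
Lemma aff_lie_loop x y : aff_loop (aff_lie x y) =
  loop_lie (aff_loop x) (aff_loop y)
    + (aff_d x *: loop_der (aff_loop y) - aff_d y *: loop_der (aff_loop x)).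
Proof. by []. Qed.
Lemma aff_lie_c x y :
  aff_c (aff_lie x y) = loop_cocycle (aff_loop x) (aff_loop y).
Proof. by []. Qed.
Lemma aff_lie_d x y : aff_d (aff_lie x y) = 0.
Proof. by []. Qed.
Fact aff_linr x : linear (aff_lie x).
Proof.
move=> a y z; apply: affP.
- rewrite aff_loopP !aff_lie_loop aff_loopP aff_dP.
  rewrite loop_linr loop_der_lin !scalerDr scalerDl opprD.
  rewrite !scalerN !scalerA (mulrC a (aff_d x)) !addrA.
  by rewrite [LHS](ACl (1*3*5*2*4*6))%AC.
- by rewrite aff_cP !aff_lie_c aff_loopP cocycle_linr.
by rewrite aff_dP !aff_lie_d mulr0 addr0.
Qed.

Lemma aff_lieC x y : aff_lie x y = - aff_lie y x.
Proof.
by apply: affP; [rewrite /aff_loop /= loop_lieC opprD opprB |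
  exact: cocycleC | rewrite /aff_d /= oppr0].
Qed.
Fact aff_linl y : linear (aff_lie^~ y).
Proof.
by move=> a x z; rewrite aff_lieC aff_linr opprD -scalerN -!aff_lieC.
Qed.

Lemma jacobi_cancel (V : zmodType) (j1 j2 j3 P Q R S T W X Y Z : V) :
  j1 + (P - Q) + (R + S + (T - W)) + (j2 + (X - S) + (- P + Y + (Z - T)))
    + (j3 + (- R - Y) + (- X + Q + (W - Z))) = j1 + j2 + j3.
Proof.
rewrite !addrA (ACl (1*8*15*(2*11)*(19*3)*(4*16)*(5*10)*(6*14)*(20*7)*(9*18)
  *(12*17)*(13*21)))%AC /=.
by rewrite !subrr !addr0.
Qed.
Lemma cyclic_cancel (V : zmodType) (j1 j2 j3 p q r : V) :
  j1 + (p - q) + (j2 + (q - r)) + (j3 + (r - p)) = j1 + j2 + j3.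
Proof.
rewrite !addrA (ACl (1*4*7*(2*9)*(5*3)*(8*6)))%AC /=.
by rewrite !subrr !addr0.
Qed.
Lemma cocycle_derC (f h : loop g) :
  loop_cocycle f (loop_der h) = loop_cocycle h (loop_der f).
Proof.
by rewrite [RHS]cocycleC; apply/eqP; rewrite -addr_eq0 addrC cocycle_der.
Qed.
Fact aff_jacobi x y z : aff_lie x (aff_lie y z) +
  aff_lie y (aff_lie z x) + aff_lie z (aff_lie x y) = 0.
Proof.
apply: affP.
- rewrite !aff_loopD !aff_lie_loop !aff_lie_d !scale0r !subr0.
  rewrite !loop_lieDr !loop_derD !loop_der_lie -!scaleN1r.
  rewrite !(loop_lieZr, loop_derZ) !scaleN1r !scalerDr !scalerN !scalerA.
  rewrite (loop_lieC (aff_loop z) (loop_der (aff_loop y))).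
  rewrite (loop_lieC (loop_der (aff_loop z)) (aff_loop x)).
  rewrite (loop_lieC (loop_der (aff_loop x)) (aff_loop y)) !scalerN.
  rewrite (mulrC (aff_d y) (aff_d x)) (mulrC (aff_d z) (aff_d x)).
  rewrite (mulrC (aff_d z) (aff_d y)).
  rewrite jacobi_cancel; exact: loop_jacobi.
- rewrite !aff_cD !aff_lie_c !aff_lie_loop !cocycleDr -!scaleN1r !cocycleZr.
  rewrite !mulN1r (cocycle_derC (aff_loop y) (aff_loop x)).
  rewrite (cocycle_derC (aff_loop z) (aff_loop y)).
  rewrite (cocycle_derC (aff_loop z) (aff_loop x)).
  rewrite cyclic_cancel; exact: cocycle_jacobi.
by rewrite !aff_dD !aff_lie_d !addr0.
Qed.
HB.instance Definition _ := Lmodule_isLie.Build k aff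
  aff_linl aff_linr aff_liexx aff_jacobi.
End Affine.

Section Subspaces.
Variables (F : fieldType) (V : lmodType F).
Implicit Types H W : V -> Prop.

Definition subspace H :=
  H 0 /\ forall (a : F) x y, H x -> H y -> H (a *: x + y).

(* w is a basis of W modulo W /\ H *)
Definition basis_mod W H n (w : 'I_n -> V) :=
  (forall i, W (w i)) /\
  forall x, W x -> exists! a : {ffun 'I_n -> F}, H (x - \sum_i a i *: w i).

(* W / (W /\ H) has dimension n *)
Definition codim W H n := exists w : 'I_n -> V, basis_mod W H w.

Definition commensurable W H :=
  (exists n, codim H W n) /\ (exists n, codim W H n).

(* dim H / (W /\ H) + dim W / (W /\ H) = n *)
Definition rel_codim W H n :=
  exists p q, [/\ codim H W p, codim W H q & n = (p + q)%N].
End Subspaces.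

Definition tens1 (k : fieldType) (A : lieType k) (K : fieldExtType k) (x : A) :
  tens A K := [ffun i => coord (vbasis {:K}) i 1 *: x].

Definition tens_sub (k : fieldType) (A : lieType k) (K : fieldExtType k)
  (S : A -> Prop) (x : tens A K) : Prop := forall i, S (x i).

(* Constructible subsets of the variety Gr(k^N) of all subspaces of k^N. The
   component Gr_d is embedded in projective space by its Pluecker coordinates,
   here indexed by all maps 'I_d -> 'I_N instead of increasing ones (this
   repeats coordinates up to sign and adds zero ones). *)
Section Grassmannian.
Variables (k : fieldType) (N : nat).

Definition pl_size d := #|{ffun 'I_d -> 'I_N}|.

Definition pluecker (K : fieldExtType k) (W : {vspace 'rV[K]_N})
    (s : 'I_(pl_size (\dim W))) : K :=
  \det (\matrix_(i < \dim W, j < \dim W) (vbasis W)`_i 0 (enum_val s j)).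

(* (E, D) stands for the locally closed set {E = 0} minus {D = 0} *)
Definition gr_piece d : Type :=
  (seq {mpoly k[pl_size d]} * seq {mpoly k[pl_size d]})%type.

Record gr_constructible := GrConstructible {
  gr_pieces : forall d, seq (gr_piece d);
  gr_homog : forall d (P : gr_piece d), P \in gr_pieces d ->
    all (fun p => p \is homog mdeg) (P.1 ++ P.2)
}.

Definition gr_point (Z : gr_constructible) (K : fieldExtType k)
    (W : {vspace 'rV[K]_N}) : bool :=
  let ev p := mmap (in_alg K) (pluecker (W := W)) p in
  has (fun P : gr_piece (\dim W) =>
         all (fun p => ev p == 0) P.1 && has (fun p => ev p != 0) P.2)
      (gr_pieces Z (\dim W)).
End Grassmannian.

(* Lie subalgebras and subspaces of L and of L (x) K are predicates on an ambient
   Lie algebra A, resp. on A (x) K. *)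
Section Classes.
Variables (k : fieldType) (A : lieType k).
Implicit Types (L : A -> Prop).

Definition lie_class := forall K : fieldExtType k, (tens A K -> Prop) -> Prop.

Variant class_kind := Subalgebras | Ideals.

(* The index set J of the filtration is nat for N-filtered algebras and int for
   Z-filtered ones. *)
Definition closed_sub J (F : J -> A -> Prop) K (H : tens A K -> Prop) :=
  forall x, (forall j, exists2 y, tens_sub (F j) y & H (x - y)) -> H x.

Definition X_class (c : class_kind) L J (F : J -> A -> Prop) : lie_class :=
  fun K H =>
  [/\ subspace H, forall x, H x -> tens_sub L x,
      forall x y, H x -> H y -> H (lie x y), closed_sub F H
    & match c with
      | Subalgebras => True
      | Ideals => forall x y, tens_sub L x -> H y -> H (lie x y)
      end].

Definition X0_class c L (F : int -> A -> Prop) : lie_class := fun K H =>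
  X_class c L F H /\ commensurable (tens_sub (F 0)) H.

Definition codim_classN L (X : lie_class) (n : nat) : lie_class := fun K H =>
  X K H /\ codim (tens_sub L) H n.
Definition codim_classZ (F : int -> A -> Prop) (X : lie_class) (n : nat) :
  lie_class := fun K H => X K H /\ rel_codim (tens_sub (F 0)) H n.

Section Stable.
(* An n plays the role of A_n(X); the Grassmannian X_l is that of U l / F l *)
Variables (An : nat -> lie_class) (F U : nat -> A -> Prop).

Definition level_class l n : lie_class := fun K H =>
  An n H /\ forall x, tens_sub (F l) x -> H x.

Definition constructible_class := forall l n,
  exists (N : nat) (b : 'I_N -> A) (Z : gr_constructible k N),
    basis_mod (U l) (F l) b /\
    forall (K : fieldExtType k) (H : tens A K -> Prop),
      level_class l n H /\ (forall x, H x -> tens_sub (U l) x) <->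
      exists2 W : {vspace 'rV[K]_N}, gr_point Z W &
        forall x, H x <-> exists2 v, v \in W &
          tens_sub (F l) (x - \sum_i v 0 i *: tens1 K (b i)).

Definition stable_class := constructible_class /\
  forall n, exists l, forall j, (l <= j)%N ->
    forall (K : fieldExtType k) (H : tens A K -> Prop),
      level_class l n H <-> level_class j n H.
End Stable.

Definition stableN L (F : nat -> A -> Prop) (X : lie_class) :=
  stable_class (codim_classN L X) F (fun=> L).
Definition stableZ (F : int -> A -> Prop) (X : lie_class) :=
  stable_class (codim_classZ F X) (fun l => F l%:Z) (fun l => F (- l%:Z)).

Definition no_infdim_abelian_quotient L := forall I : A -> Prop,
  subspace I -> (forall x, I x -> L x) ->
  (forall x y, L x -> I y -> I (lie x y)) ->
  (forall x y, L x -> L y -> I (lie x y)) -> exists n, codim L I n.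
End Classes.

Section Simple.
Variables (k : fieldType) (g : fdLieType k).

Definition simple_lie := (exists x y : g, lie x y <> 0) /\
  forall I : {vspace g}, (forall x y, y \in I -> lie x y \in I) ->
    I = 0%VS \/ I = {:g}%VS.

Definition lie_automorphism (f : 'End(g)) :=
  bijective f /\ forall x y, f (lie x y) = lie (f x) (f y).

Definition has_order (f : 'End(g)) (m : nat) :=
  [/\ (0 < m)%N, iter m f =1 id
    & forall j, (0 < j < m)%N -> ~ iter j f =1 id].
End Simple.

Section KacMoody.
Variables (k : fieldType) (q : nat) (g : 'I_q -> fdLieType k).
Variables (alpha : forall i, 'End(g i)) (m : 'I_q -> nat) (eps : 'I_q -> k).

Definition aff_prod : Type := lprod (fun i => aff (g i) : lieType k).
HB.instance Definition _ := Lie.on aff_prod.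

(* The component of degree n at i of an element of L lies in the eigenspace
   g_{i, n mod m_i} of alpha i. *)
Definition kac_moody (x : aff_prod) : Prop := forall i (n : int),
  loop_at (aff_loop (lprod_at x i)) n
    \in passmx.leigenspace (alpha i) (eps i ^ (n %% m i)%Z).

Definition degree_part_eq0 (n : int) (x : aff_prod) : Prop := forall i,
  loop_at (aff_loop (lprod_at x i)) n = 0 /\
  (n = 0 -> aff_c (lprod_at x i) = 0 /\ aff_d (lprod_at x i) = 0).

Definition kac_moody_filt (j : int) (x : aff_prod) : Prop :=
  kac_moody x /\ forall n : int, n < j -> degree_part_eq0 n x.
End KacMoody.

Import Order.TTheory Num.Theory.
(* L is a Lie subalgebra of aff_prod, filtered by the L_j *)
Section KacMoodyFiltered.
Variables (k : fieldType) (q : nat) (g : 'I_q -> fdLieType k)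
    (alpha : forall i, 'End(g i)) (m : 'I_q -> nat) (eps : 'I_q -> k).
Hypothesis alphaP : forall i, lie_automorphism (alpha i).
Hypothesis epsP : forall i, (m i).-primitive_root (eps i).

Lemma eps_modE i n : eps i ^ (n %% m i)%Z = eps i ^ n.
Proof.
have m0 := prim_order_gt0 (epsP i).
have e0 : eps i != 0.
  apply/eqP => e0; have := prim_expr_order (epsP i).
  by rewrite e0 expr0n gtn_eqF //= => /esym/eqP; rewrite oner_eq0.
rewrite [in RHS](divz_eq n (m i)) [RHS]expfzDr // (mulrC _ (m i : int)).
by rewrite -exprz_exp -exprnP (prim_expr_order (epsP i)) exp1rz mul1r.
Qed.
Lemma mem_eigenspaceP i x n : x \in passmx.leigenspace (alpha i) (eps i ^ (n %% m i)%Z) <-> alpha i x = eps i ^ n *: x.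
Proof.
rewrite eps_modE /passmx.leigenspace memv_ker !(add_lfunE, opp_lfunE, scale_lfunE) id_lfunE subr_eq0.
by split=> /eqP.
Qed.
Lemma kac_moody_subspace : subspace (kac_moody alpha m eps).
Proof.
split=> [i n|a x y Lx Ly i n].
  by rewrite lprodE loopE0 mem0v.
rewrite !lprodE aff_loopP loopED loopEZ; apply: memvD; [exact/memvZ/Lx|exact: Ly].
Qed.
Lemma kac_moody_lie x y : kac_moody alpha m eps x -> kac_moody alpha m eps y -> kac_moody alpha m eps (lie x y).
Proof.
move=> Lx Ly i n; rewrite lprodE aff_lie_loop !loopED loopEN !loopEZ !loop_derE loop_lieE.
apply: memvD.
  apply: memv_suml => p _.
  apply/mem_eigenspaceP; rewrite (alphaP i).2.
  have /mem_eigenspaceP -> := Lx i p; have /mem_eigenspaceP -> := Ly i (n - p).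
  rewrite lieZl lieZr scalerA -expfzDr; first by rewrite addrC subrK.
  apply/eqP => e0; have := prim_expr_order (epsP i).
  by rewrite e0 expr0n gtn_eqF ?(prim_order_gt0 (epsP i)) //= => /esym/eqP; rewrite oner_eq0.
by apply: memvB; do 2!apply: memvZ; [exact: Ly|exact: Lx].
Qed.
Lemma kac_moody_filt_lie i j x y : kac_moody_filt alpha m eps i x -> kac_moody_filt alpha m eps j y -> kac_moody_filt alpha m eps (i + j) (lie x y).
Proof.
move=> [Lx Fx] [Ly Fy]; split; first exact: kac_moody_lie.
have Fx0 r n : n < i -> loop_at (aff_loop (lprod_at x r)) n = 0 by move=> /Fx/(_ r)[].
have Fy0 r n : n < j -> loop_at (aff_loop (lprod_at y r)) n = 0 by move=> /Fy/(_ r)[].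
move=> n nij r; rewrite !lprodE; split; last first.
  move=> n0; split=> //; rewrite /lie /= aff_lie_c /loop_cocycle big1 // => p _.
  case: (ltrP p i) => pi; first by rewrite Fx0 // killing0l mulr0.
  rewrite (Fy0 r (- p)) ?killing0r ?mulr0 // ltrNl -subr_gt0 opprK.
  by move: nij; rewrite n0 => /lt_le_trans; apply; rewrite ?(addrC _ j) lerD2l.
rewrite aff_lie_loop !loopED loopEN !loopEZ !loop_derE loop_lieE.
have dterm (u : k) (v : g r) (l : int) : (0 < l -> u = 0) -> (l <= 0 -> v = 0) ->
    u *: v = 0.
  by move=> u0 v0; case: (ltrP 0 l) => [/u0->|/v0->];
    rewrite ?scale0r ?scaler0.
have dx0 : 0 < i -> aff_d (lprod_at x r) = 0.
  by move=> /Fx/(_ r)[_ /(_ erefl)[]].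
have dy0 : 0 < j -> aff_d (lprod_at y r) = 0.
  by move=> /Fy/(_ r)[_ /(_ erefl)[]].
rewrite big1 => [|p _]; last first.
  case: (ltrP p i) => pi; first by rewrite Fx0 // lie0l.
  rewrite (Fy0 r (n - p)) ?lie0r // ltrBlDr (lt_le_trans nij) //.
  by rewrite ?(addrC _ j) lerD2l.
rewrite (dterm _ _ i dx0) => [|i0]; last first.
  by rewrite Fy0 ?scaler0 // (lt_le_trans nij) // gerDr.
rewrite (dterm _ _ j dy0) => [|j0]; first by rewrite subrr addr0.
by rewrite Fx0 ?scaler0 // (lt_le_trans nij) // gerDl.
Qed.

End KacMoodyFiltered.

(* Main.v *)
Require Import Defs.
From HB Require Import structures.
From mathcomp Require Import all_boot all_order all_algebra all_field.
From mathcomp Require Import finmap mpoly zify.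
From Stdlib Require Import Classical FunctionalExtensionality PropExtensionality.
Set Implicit Arguments.
Unset Strict Implicit.
Unset Printing Implicit Defensive.
Import GRing.Theory Order.TTheory Num.Theory.
Local Open Scope ring_scope.

(** Two things have to be shown.

    Stability. A closed subalgebra [H] that contains some L_j and has codimension
    [n] in L_0 must contain L_l for an [l] depending on [n] only. Call a degree [i]
    full when L_i is contained in H + L_{i+1}. At most [n] degrees are not full
    ([full_degree_among]), and if [p] and [N - p] are full, then so is every bracket
    of L_p and L_{N-p} in degree [N] ([full_mod_lie]). A simple algebra is perfect,
    so its eigenspace of degree [N] is spanned by brackets of an eigenvector of
    degree [r] and one of degree [N - r], [r] running over the residues modulo the
    order of the automorphism ([graded_perfect]). For [N] large, every residue class
    contains a [p] for which [p] and [N - p] are both full ([full_degree_pair]).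
    Hence all large degrees are full, and since [H] contains some L_j it contains
    L_l ([filt_sub_subalgebra]).

    Constructibility. Subspaces [H] with L_l <= H <= U, where [U] is L_0 or L_{-l},
    are the preimages of subspaces [W] of the finite dimensional space U / L_l. Being
    closed under the bracket is a finite list of conditions: [W] is stable under
    certain linear maps and under a bilinear map, all with coefficients in [k]. If
    p_f are the Pluecker coordinates of [W] and f is a tuple of columns, replacing one
    entry of f by a varying column yields a row of Pluecker coordinates that lies in
    [W]; these rows span [W], and Cramer's rule expresses membership in [W] through
    them ([mem_cramer]). The conditions thus become homogeneous equations of degree
    at most 3 in the p_f. The codimension depends on the dimension of the intersection of
    [W] with the coordinate subspace L_0 / L_l, which is read off from the p_f that do
    not vanish ([dim_cap_coord_space]), a locally closed condition.

    In the [int]-filtered case the ideals need a separate argument, because bracketing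
    with all of L is an infinite list of conditions. But an ideal that contains L_l
    contains nonzero elements of arbitrarily negative degree, so none lies between
    L_l and L_{-l} unless L = 0 ([no_bounded_ideal]). *)

(** * Subspaces and relative dimension *)

Section SubspaceTheory.
Variables (F : fieldType) (V : lmodType F).
Implicit Types H W U : V -> Prop.

Lemma subspace0 H : subspace H -> H 0.
Proof. by case. Qed.
Lemma subspaceD H x y : subspace H -> H x -> H y -> H (x + y).
Proof. by move=> [_ hH] /(hH 1) h /h; rewrite scale1r. Qed.
Lemma subspaceZ H a x : subspace H -> H x -> H (a *: x).
Proof. by move=> [H0 hH] Hx; have := hH a x 0 Hx H0; rewrite addr0. Qed.
Lemma subspaceN H x : subspace H -> H x -> H (- x).
Proof. by rewrite -scaleN1r; exact: subspaceZ. Qed.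
Lemma subspaceB H x y : subspace H -> H x -> H y -> H (x - y).
Proof. by move=> hH Hx Hy; apply: subspaceD => //; apply: subspaceN. Qed.
Lemma subspace_sum H I (r : seq I) (P : pred I) (G : I -> V) :
  subspace H -> (forall i, P i -> H (G i)) -> H (\sum_(i <- r | P i) G i).
Proof.
move=> hH HG; elim/big_ind: _ => //; first exact: subspace0.
by move=> x y; apply: subspaceD.
Qed.
Lemma subspace_addl H x y : subspace H -> H x -> H (x + y) -> H y.
Proof.
move=> hH Hx Hxy; rewrite -(addrK x y) addrC [y + x]addrC.
by apply: subspaceD => //; exact: subspaceN.
Qed.
Lemma subspace_eqmod H x y : subspace H -> H (x - y) -> H y -> H x.
Proof. by move=> hH h Hy; rewrite -(subrK y x); exact: subspaceD. Qed.
Lemma subspace_eqmod_sym H x y : subspace H -> H (x - y) -> H (y - x).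
Proof. by move=> hH h; rewrite -opprB; exact: subspaceN. Qed.

Lemma basis_mod_uniq W H n (w : 'I_n -> V) (a b : 'I_n -> F) :
  subspace W -> subspace H -> basis_mod W H w ->
  H (\sum_i a i *: w i - \sum_i b i *: w i) -> a =1 b.
Proof.
move=> sW sH [Ww ex] Hab.
have [c [_ uc]] : exists! c : {ffun 'I_n -> F}, H (\sum_i b i *: w i - \sum_i c i *: w i).
  by apply: ex; apply: subspace_sum => // i _; apply: subspaceZ.
have ea : c = [ffun i => a i].
  apply: uc; under [X in _ - X]eq_bigr do rewrite ffunE.
  exact: subspace_eqmod_sym.
have eb : c = [ffun i => b i].
  apply: uc; under [X in _ - X]eq_bigr do rewrite ffunE.
  by rewrite subrr; exact: subspace0.
move=> i; have := congr1 (fun f : {ffun _ -> _} => f i) (etrans (esym ea) eb).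
by rewrite !ffunE.
Qed.

Lemma basis_mod_free W H n (w : 'I_n -> V) (a : 'I_n -> F) :
  subspace W -> subspace H -> basis_mod W H w ->
  H (\sum_i a i *: w i) -> a =1 fun=> 0.
Proof.
move=> sW sH bw Ha; apply: (basis_mod_uniq sW sH bw).
by rewrite [X in _ - X]big1 ?subr0 // => i _; rewrite scale0r.
Qed.

Lemma basis_mod_intro W H n (w : 'I_n -> V) : subspace H ->
  (forall i, W (w i)) ->
  (forall x, W x -> exists a : 'I_n -> F, H (x - \sum_i a i *: w i)) ->
  (forall a : 'I_n -> F, H (\sum_i a i *: w i) -> a =1 fun=> 0) ->
  basis_mod W H w.
Proof.
move=> sH Ww ex fr; split=> // x /ex[a Ha]; exists [ffun i => a i]; split.
  by under eq_bigr do rewrite ffunE.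
move=> b Hb; apply/ffunP => i; rewrite ffunE; apply/eqP; rewrite -subr_eq0.
apply/eqP; apply: (fr (fun i => a i - b i)).
under eq_bigr do rewrite scalerBl.
rewrite sumrB -(subrKA x) [X in H X]addrC -[X in _ + X]opprB.
exact: subspaceB.
Qed.

Lemma basis_mod_spanning W H n (w : 'I_n -> V) x : basis_mod W H w -> W x ->
  exists a : 'I_n -> F, H (x - \sum_i a i *: w i).
Proof. by move=> [_ ex] /ex[a [Ha _]]; exists a. Qed.

(** The coordinates of the [x i] modulo [H] form an [N] x [n] matrix, which has a
    nonzero left kernel. *)
Lemma codim_dependent W H n N (x : 'I_N -> V) : subspace H -> codim W H n -> (n < N)%N ->
  (forall i, W (x i)) ->
  exists2 u : 'I_N -> F, (exists i, u i != 0) & H (\sum_i u i *: x i).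
Proof.
move=> sH [w bw] nN Wx.
have /fin_all_exists[a Ha] i := basis_mod_spanning bw (Wx i).
pose A := \matrix_(i < N, j < n) a i j.
have : kermx A != 0.
  rewrite -mxrank_eq0 mxrank_ker subn_eq0 -ltnNge.
  exact: leq_ltn_trans (rank_leq_col A) nN.
case/rowV0Pn => u /sub_kermxP uA u0; exists (u 0).
  by case/rV0Pn: u0 => i ui; exists i.
suff -> : \sum_i u 0 i *: x i = \sum_i u 0 i *: (x i - \sum_j a i j *: w j).
  by apply: subspace_sum => // i _; apply: subspaceZ.
under [RHS]eq_bigr do rewrite scalerBr scaler_sumr.
rewrite sumrB exchange_big /= [X in _ - X]big1 ?subr0 // => j _.
under eq_bigr do rewrite scalerA.
rewrite -scaler_suml; have /rowP/(_ j) := uA; rewrite !mxE => uAj.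
rewrite (eq_bigr (fun i => u 0 i * A i j)) ?uAj ?scale0r // => i _.
by rewrite mxE.
Qed.

Lemma codim_uniq W H n n' : subspace W -> subspace H ->
  codim W H n -> codim W H n' -> n = n'.
Proof.
move=> sW sH; wlog lt : n n' / (n < n')%N.
  case: (ltngtP n n') => // h wl c c'; first exact: wl.
  by apply/esym; exact: wl.
move=> c [w' bw']; have [u [i ui]] := codim_dependent sH c lt bw'.1.
by move=> /(basis_mod_free sW sH bw')/(_ i)/eqP; rewrite (negPf ui).
Qed.

Lemma basis_mod_cat U W H m n (u : 'I_m -> V) (w : 'I_n -> V) :
  subspace U -> subspace W -> subspace H ->
  (forall x, W x -> U x) -> (forall x, H x -> W x) ->
  basis_mod U W u -> basis_mod W H w ->
  basis_mod U H (fun i => match split i with inl i => u i | inr i => w i end).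
Proof.
move=> sU sW sH WU HW bu bw.
have sumE (a : 'I_(m + n) -> F) :
    \sum_i a i *: (match split i with inl i => u i | inr i => w i end) =
    \sum_i a (lshift n i) *: u i + \sum_i a (rshift m i) *: w i.
  rewrite big_split_ord; congr (_ + _); apply: eq_bigr => i _.
    by rewrite -[lshift n i]/(unsplit (inl i)) unsplitK.
  by rewrite -[rshift m i]/(unsplit (inr i)) unsplitK.
have Wsum (a : 'I_n -> F) : W (\sum_i a i *: w i).
  by apply: subspace_sum => // i _; apply: subspaceZ => //; apply: bw.1.
apply: basis_mod_intro => //.
- by move=> i; case: (split i) => j; [apply: bu.1|apply/WU/bw.1].
- move=> x /(basis_mod_spanning bu)[a Wa].
  have [b Hb] := basis_mod_spanning bw Wa.
  exists (fun i => match split i with inl i => a i | inr i => b i end).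
  rewrite sumE opprD addrA; move: Hb; congr (H (_ - _ - _)); apply: eq_bigr => i _.
    by rewrite -[lshift n i]/(unsplit (inl i)) unsplitK.
  by rewrite -[rshift m i]/(unsplit (inr i)) unsplitK.
move=> a; rewrite sumE => Ha i.
have a0 : a \o lshift n =1 fun=> 0.
  apply: (basis_mod_free sU sW bu); have := HW _ Ha; rewrite addrC.
  exact: subspace_addl.
have b0 : a \o @rshift m n =1 fun=> 0.
  apply: (basis_mod_free sW sH bw); move: Ha.
  by rewrite big1 ?add0r // => j _; rewrite [a _]a0 scale0r.
by rewrite -[i]splitK; case: (split i) => j; [exact: a0|exact: b0].
Qed.

Lemma codim_trans U W H m n : subspace U -> subspace W -> subspace H ->
  (forall x, W x -> U x) -> (forall x, H x -> W x) ->
  codim U W m -> codim W H n -> codim U H (m + n).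
Proof.
move=> sU sW sH WU HW [u bu] [w bw].
exact: ex_intro (basis_mod_cat sU sW sH WU HW bu bw).
Qed.

Lemma codim_ext W (H H' : V -> Prop) n :
  (forall x, H x <-> H' x) -> codim W H n -> codim W H' n.
Proof.
move=> HH' [w [Ww ex]]; exists w; split=> // x /ex[a [Ha ua]]; exists a.
by split=> [|b /HH'/ua//]; apply/HH'.
Qed.

Lemma codim_refl W : subspace W -> codim W W 0.
Proof.
move=> sW; have w : 'I_0 -> V by case.
exists w; apply: basis_mod_intro => //; try by case.
- by move=> x Wx; exists (fun=> 0); rewrite big_ord0 subr0.
- by move=> a _ [].
Qed.

End SubspaceTheory.

Lemma subspaceI (F : fieldType) (V : lmodType F) (H W : V -> Prop) :
  subspace H -> subspace W -> subspace (fun x => H x /\ W x).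
Proof.
move=> [H0 HD] [W0 WD]; split=> // a x y [Hx Wx] [Hy Wy].
by split; [apply: HD|apply: WD].
Qed.

Lemma subspace_preim (F : fieldType) (U V : lmodType F) (f : {linear U -> V})
    (H : V -> Prop) :
  subspace H -> subspace (fun x => H (f x)).
Proof.
by move=> [H0 HD]; split=> [|a x y Hx Hy]; rewrite ?linear0 // linearP; apply: HD.
Qed.

Section FiniteDim.
Variables (F : fieldType) (V : vectType F).

Lemma vspace_of_subspace (P : V -> Prop) : subspace P ->
  exists X : {vspace V}, forall v, v \in X <-> P v.
Proof.
move=> sP.
(* enlarge a subspace contained in [P] by a vector of [P] until they agree;
   [c] bounds the number of steps left *)
suff main c : forall Y : {vspace V}, (forall v, v \in Y -> P v) ->
    (\dim {:V} - \dim Y <= c)%N -> exists X : {vspace V}, forall v, v \in X <-> P v.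
  by apply: (main _ 0%VS _ (leqnn _)) => v; rewrite memv0 => /eqP->; exact: subspace0.
elim: c => [|c IH] Y YP lec;
  have [YP'|/not_all_ex_not[v nv]] := classic (forall v, P v -> v \in Y).
- by exists Y => v; split; [exact: YP|exact: YP'].
- have : (Y == fullv) by rewrite eqEdim subvf -subn_eq0 -leqn0.
  by move=> /eqP eY; case: nv; rewrite eY memvf.
- by exists Y => v; split; [exact: YP|exact: YP'].
have [Pv nY] := imply_to_and _ _ nv.
have lt : (\dim Y < \dim (Y + <[v]>))%N.
  rewrite (ltn_leqif (dimv_leqif_sup (addvSl _ _))) subv_add subvv /=.
  by rewrite -memvE; apply/negP.
apply: (IH (Y + <[v]>)%VS) => [u /memv_addP[y Yy [w /vlineP[a ->] ->]]|].
  by apply: subspaceD => //; [exact: YP|exact: subspaceZ].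
rewrite -ltnS; apply: leq_trans lec; apply: ltn_sub2l => //.
by apply: (leq_trans lt); rewrite dimvS ?subvf.
Qed.

Lemma codim_ker (A : lmodType F) (U : A -> Prop) (f : {linear A -> V}) : subspace U ->
  exists n, codim U (fun x => U x /\ f x = 0) n.
Proof.
move=> sU.
have [X XP] : exists X : {vspace V}, forall v, v \in X <-> exists2 x, U x & f x = v.
  apply: vspace_of_subspace; split.
    by exists 0; rewrite ?linear0 //; exact: subspace0.
  move=> a _ _ [x Ux <-] [y Uy <-]; exists (a *: x + y); rewrite ?linearP //.
  by apply: subspaceD => //; exact: subspaceZ.
have e i : exists x, U x /\ f x = (vbasis X)`_i :> V.
  move: i => i; have [|x Ux ex] := (XP (vbasis X)`_i).1; last by exists x.
  have [lt|ge] := ltnP i (\dim X).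
    by apply: vbasis_mem; rewrite mem_nth ?size_tuple.
  by rewrite nth_default ?mem0v ?size_tuple.
have /fin_all_exists[w Hw] (i : 'I_(\dim X)) := e i.
have sH : subspace (fun x => U x /\ f x = 0).
  apply: subspaceI => //; split=> [|a x y fx fy]; first exact: linear0.
  by rewrite linearP /= fx fy scaler0 addr0.
exists (\dim X), w; apply: basis_mod_intro => //.
- by move=> i; case: (Hw i).
- move=> x Ux; have fX : f x \in X by apply/XP; exists x.
  exists (fun i => coord (vbasis X) i (f x)); split.
    apply: subspaceB => //; apply: subspace_sum => // i _.
    by apply: subspaceZ => //; case: (Hw i).
  rewrite linearB linear_sum [in X in X - _](coord_vbasis fX) /= -sumrB big1 // => i _.
  by rewrite linearZ /= (Hw i).2 subrr.
move=> a [_]; rewrite linear_sum /=.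
under eq_bigr do rewrite linearZ (Hw _).2 /=.
by have /freeP fr := basis_free (vbasisP X); exact: fr.
Qed.
End FiniteDim.

(** * Maximal minors and the row space of a matrix *)

Definition replace_at (I : finType) (T : Type) (f : {ffun I -> T}) h j : {ffun I -> T} :=
  [ffun i => if i == h then j else f i].

Section Minors.
Variables (K : fieldType) (d N : nat) (B : 'M[K]_(d, N)).
Implicit Types f : {ffun 'I_d -> 'I_N}.

Definition minor f : K := \det (\matrix_(i, j) B i (f j)).
(** Up to the factor [minor f] these are the rows of [B] in reduced form with
    respect to the columns selected by [f]; unlike those they are polynomial in the
    minors. *)
Definition exchange_row f h : 'rV[K]_N := \row_j minor (replace_at f h j).

(** Laplace expansion along the column that varies. *)
Lemma exchange_rowE f h :
  exchange_row f h = row h (\adj (\matrix_(i, j) B i (f j)) *m B).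
Proof.
apply/rowP => j; rewrite !mxE /minor (expand_det_col _ h).
apply: eq_bigr => i _; rewrite !mxE ffunE eqxx mulrC; congr (_ * _).
rewrite /cofactor; congr (_ * \det _); apply/matrixP => r s.
by rewrite !mxE ffunE eq_sym (negPf (neq_lift h s)).
Qed.

Lemma exchange_row_sub f h : (exchange_row f h <= B)%MS.
Proof. by rewrite exchange_rowE row_mul submxMl. Qed.

(** Cramer's rule: if [x = a *m B], its entries in the columns [f] are [a] times the
    square submatrix, and the product of that submatrix with its adjugate is [minor f].
    No assumption on [minor f] is made, so this is an identity between polynomials. *)
Lemma cramer_sub f (x : 'rV[K]_N) : (x <= B)%MS ->
  minor f *: x = \sum_h x 0 (f h) *: exchange_row f h.
Proof.
case/submxP => a ->; set Bf := \matrix_(i, j) B i (f j).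
have -> : \sum_h (a *m B) 0 (f h) *: exchange_row f h = (a *m Bf) *m (\adj Bf *m B).
  rewrite [RHS]mulmx_sum_row; apply: eq_bigr => h _; rewrite exchange_rowE.
  by congr (_ *: _); rewrite !mxE; apply: eq_bigr => i _; rewrite mxE.
rewrite -[RHS]mulmxA (mulmxA Bf) mul_mx_adj -[\det _]/(minor f).
by rewrite mul_scalar_mx -scalemxAr.
Qed.

Lemma minor_neq0 : row_free B -> exists f, minor f != 0.
Proof.
move=> fB; have fBT : row_full B^T by rewrite /row_full mxrank_tr.
exists (fullrankfun fBT); rewrite /minor -unitfE -[_ \is a _]/(_ \in unitmx).
rewrite -unitmx_tr; have := fullrowsub_unit fBT; congr (_ \in unitmx).
by apply/matrixP => i j; rewrite !mxE.
Qed.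

Lemma exchange_row_at f h h' : exchange_row f h 0 (f h') = (h == h')%:R * minor f.
Proof.
rewrite mxE; have [<-|ne] := eqVneq h h'.
  by rewrite mul1r; congr minor; apply/ffunP => i; rewrite ffunE; case: eqP => // ->.
rewrite mul0r /minor -det_tr; apply: (determinant_alternate ne) => i.
by rewrite !mxE !ffunE eqxx eq_sym (negPf ne).
Qed.
End Minors.

Section RowSpaces.
Variables (K : fieldType) (N : nat).
Implicit Types W X : {vspace 'rV[K]_N}.

Lemma dim_rowspace n (A : 'M[K]_(n, N)) X :
  row_free A -> (forall x, x \in X <-> (x <= A)%MS) -> \dim X = n.
Proof.
move=> fA XA; pose phi := linfun (mulmxr A : 'rV_n -> 'rV_N).
have phiE a : phi a = a *m A by rewrite lfunE.
have -> : X = limg phi.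
  apply/vspaceP => x; apply/idP/memv_imgP => [/XA/submxP[a ->]|[a _ ->]].
    by exists a; rewrite ?memvf ?phiE.
  by apply/XA; rewrite phiE submxMl.
rewrite limg_dim_eq ?dimvf ?dim_matrix ?mul1r ?mul1n //.
apply/eqP; rewrite -subv0 capfv; apply/subvP => a.
rewrite memv_ker phiE memv0 => /eqP a0; apply/eqP.
by apply: (row_free_inj fA); rewrite mul0mx.
Qed.

Definition vbasis_mx W : 'M[K]_(\dim W, N) := \matrix_(i, j) (vbasis W)`_i 0 j.

Lemma row_vbasis_mx W i : row i (vbasis_mx W) = (vbasis W)`_i.
Proof. by apply/rowP => j; rewrite !mxE. Qed.

Lemma vbasis_mx_free W : row_free (vbasis_mx W).
Proof.
have /freeP fr := basis_free (vbasisP W).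
rewrite -kermx_eq0; apply/rowV0P => a /sub_kermxP.
rewrite mulmx_sum_row => a0; apply/rowP => i; rewrite mxE.
by apply: (fr (a 0)); rewrite -[RHS]a0; apply: eq_bigr => j _; rewrite row_vbasis_mx.
Qed.

Lemma vbasis_mxP W x : x \in W <-> (x <= vbasis_mx W)%MS.
Proof.
split=> [/coord_vbasis ->|/submxP[a ->]].
  by apply: summx_sub => i _; rewrite -row_vbasis_mx scalemx_sub ?row_sub.
rewrite mulmx_sum_row; apply: memv_suml => i _; rewrite row_vbasis_mx memvZ //.
by rewrite vbasis_mem // mem_nth // size_tuple.
Qed.

Definition coord_space (Neg : pred 'I_N) : {vspace 'rV[K]_N} :=
  lker (linfun (mulmxr (diag_mx (\row_j (Neg j)%:R)) : 'rV[K]_N -> 'rV[K]_N)).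

Lemma coord_spaceP (Neg : pred 'I_N) x :
  x \in coord_space Neg <-> forall j, Neg j -> x 0 j = 0.
Proof.
rewrite memv_ker lfunE /=.
have e j : (x *m diag_mx (\row_j (Neg j)%:R)) 0 j = x 0 j * (Neg j)%:R.
  rewrite mxE (bigD1 j) //= big1 ?addr0 ?mxE ?eqxx ?mulr1n // => i /negPf ne.
  by rewrite !mxE ne mulr0n mulr0.
split=> [/eqP/rowP x0 j Nj|x0].
  by have := x0 j; rewrite e Nj mulr1 mxE.
apply/eqP/rowP => j; rewrite e mxE; case Nj: (Neg j); last exact: mulr0.
by rewrite x0 ?Nj ?mul0r.
Qed.

Lemma dim_coord_space (Neg : pred 'I_N) : \dim (coord_space Neg) = #|predC Neg|.
Proof.
pose A : 'M[K]_(#|predC Neg|, N) := \matrix_(i, j) (enum_val i == j)%:R.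
apply: (@dim_rowspace _ A).
  apply/row_freeP; exists A^T; apply/matrixP => i i'.
  rewrite !mxE (bigD1 (enum_val i)) //= !mxE eqxx mul1r.
  rewrite big1 ?addr0 => [|j /negPf ne]; last by rewrite !mxE eq_sym ne mul0r.
  by rewrite (inj_eq enum_val_inj) eq_sym.
move=> x; split=> [/coord_spaceP x0|/submxP[a ->]].
  rewrite [x]row_sum_delta (bigID (mem (predC Neg))) /= [X in _ + X]big1 ?addr0.
    rewrite (big_enum_val (A := predC Neg)); apply: summx_sub => i _.
    rewrite scalemx_sub // (_ : delta_mx _ _ = row i A) ?row_sub //.
    by apply/rowP => j; rewrite !mxE eqxx eq_sym.
  by move=> j; rewrite negbK => Nj; rewrite x0 ?scale0r.
apply/coord_spaceP => j Nj; rewrite mxE big1 // => i _; rewrite mxE.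
case: eqP => [e|_]; last by rewrite mulr0.
by have := enum_valP i; rewrite e inE /= Nj.
Qed.
End RowSpaces.

(** * Subspaces and their Pluecker coordinates *)

Section Schubert.
Variables (K : fieldType) (N : nat) (Neg : pred 'I_N) (W : {vspace 'rV[K]_N}).
Local Notation d := (\dim W).
Local Notation B := (vbasis_mx W).

Lemma exchange_row_mem (f : {ffun 'I_d -> 'I_N}) h : exchange_row B f h \in W.
Proof. by apply/vbasis_mxP; apply: exchange_row_sub. Qed.

Lemma minor_vbasis_neq0 : exists f : {ffun 'I_d -> 'I_N}, minor B f != 0.
Proof. exact: minor_neq0 (vbasis_mx_free W). Qed.

(** Membership in [W] as equations that are linear in [x] and linear in the minors:
    an [f] with nonzero minor makes them sufficient. *)
Lemma mem_cramer x : x \in W <-> forall f : {ffun 'I_d -> 'I_N},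
  minor B f *: x = \sum_h x 0 (f h) *: exchange_row B f h.
Proof.
split=> [/vbasis_mxP xW f|xE]; first exact: cramer_sub.
have [f f0] := minor_vbasis_neq0.
rewrite -(scalerK f0 x) xE memvZ // memv_suml // => h _.
by rewrite memvZ // exchange_row_mem.
Qed.

Lemma exchange_row_ind (P : 'rV[K]_N -> Prop) : subspace P ->
  (forall (f : {ffun 'I_d -> 'I_N}) h, P (exchange_row B f h)) ->
  forall x, x \in W -> P x.
Proof.
move=> sP Pf x /mem_cramer xE; have [f f0] := minor_vbasis_neq0.
rewrite -(scalerK f0 x) xE; apply: subspaceZ => //; apply: subspace_sum => // h _.
exact: subspaceZ.
Qed.

(** When the minor of [f] is nonzero the counted columns are independent; over all such
    [f] the maximal count is the rank of the columns in [Neg]. *)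
Definition neg_count (f : {ffun 'I_d -> 'I_N}) := #|[pred h | Neg (f h)]|.

Lemma neg_count_le f : (neg_count f <= d)%N.
Proof. by rewrite -[X in (_ <= X)%N]card_ord max_card. Qed.

(** Exchange argument. If [f] has as many columns in [Neg] as possible and [f h] is
    not in [Neg], then replacing [f h] by a column of [Neg] must give the minor 0: the
    row [exchange_row B f h] vanishes on [Neg]. These rows form a basis of the
    intersection, since by Cramer's rule an element that vanishes on [Neg] only
    involves them. *)
Lemma dim_cap_coord_space (f : {ffun 'I_d -> 'I_N}) : minor B f != 0 ->
  (forall f' : {ffun 'I_d -> 'I_N}, minor B f' != 0 -> (neg_count f' <= neg_count f)%N) ->
  \dim (W :&: coord_space K Neg) = (d - neg_count f)%N.
Proof.
move=> f0 fmax; pose S := [pred h | ~~ Neg (f h)].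
have -> : (d - neg_count f)%N = #|S|.
  rewrite -[X in (X - _)%N]card_ord -(cardC [pred h | Neg (f h)]) addKn.
  by apply: eq_card => h; rewrite !inE.
(* replacing the column [f h] outside [Neg] by [j] in [Neg] raises the count *)
have posS h j : h \in S -> Neg j -> exchange_row B f h 0 j = 0.
  move=> Sh Nj; rewrite mxE; apply/eqP; apply: contraTT (leqnn (neg_count f)) => nz.
  rewrite -ltnNge; apply: leq_trans (fmax _ nz); rewrite /neg_count.
  rewrite [X in (_ < X)%N](cardD1 h) inE ffunE eqxx Nj ltnS.
  apply/subset_leq_card/subsetP => i; rewrite !inE ffunE => Ni.
  by case: eqP => [ei|_] //; move: Sh; rewrite inE -ei Ni.
apply: (@dim_rowspace _ _ _ (\matrix_(i < #|S|) exchange_row B f (enum_val i))).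
  apply/row_freeP; exists (\matrix_(j, i) ((j == f (enum_val i))%:R / minor B f)).
  apply/matrixP => i i'; rewrite !mxE (bigD1 (f (enum_val i'))) //=.
  rewrite big1 ?addr0 => [|j /negPf ne]; last by rewrite !mxE ne mul0r mulr0.
  by rewrite mxE exchange_row_at mxE eqxx mul1r mulfK // (inj_eq enum_val_inj).
move=> x; split=> [|/submxP[a ->]].
  rewrite memv_cap => /andP[/mem_cramer/(_ f) xE /coord_spaceP x0].
  rewrite -(scalerK f0 x) scalemx_sub // xE (bigID (mem S)) /= [X in _ + X]big1 ?addr0.
    rewrite (big_enum_val (A := S)); apply: summx_sub => i _.
    by rewrite scalemx_sub // -(rowK (fun i => exchange_row B f (enum_val i))) row_sub.
  by move=> h; rewrite negbK => Nh; rewrite x0 ?scale0r.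
rewrite mulmx_sum_row; apply: memv_suml => i _; rewrite rowK memvZ // memv_cap.
rewrite exchange_row_mem; apply/coord_spaceP => j; apply: posS.
exact: enum_valP.
Qed.

Lemma dim_cap_coord_spaceP :
  exists2 f : {ffun 'I_d -> 'I_N}, minor B f != 0 &
    (forall f' : {ffun 'I_d -> 'I_N}, minor B f' != 0 -> (neg_count f' <= neg_count f)%N).
Proof.
have [f0 nz0] := minor_vbasis_neq0.
case: (@arg_maxnP _ f0 (fun f => minor B f != 0) neg_count nz0) => f nz fmax.
by exists f => // f'; exact: fmax.
Qed.
End Schubert.

Lemma all_map_enum (I : finType) T (a : pred T) (G : I -> T) :
  all a [seq G u | u <- enum I] <-> forall u, a (G u).
Proof.
rewrite all_map; split=> [h v|aG]; last exact/allT.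
by have /allP/(_ v)/= := h; apply; rewrite mem_enum.
Qed.

Lemma all_flatten_enum (I : finType) T (a : pred T) (G : I -> seq T) :
  all a (flatten [seq G u | u <- enum I]) <-> forall u, all a (G u).
Proof.
apply: iff_trans (all_map_enum (all a) G).
by elim: [seq _ | u <- _] => //= s r IH; rewrite all_cat; split=> /andP[-> /IH].
Qed.

(** * Equations in Pluecker coordinates *)

Section Polynomials.
Variables (k : fieldType) (N : nat).

Section Fixed_d.
Variables (N' d : nat).
Local Notation R := {mpoly k[pl_size N d]}.
Implicit Types f : {ffun 'I_d -> 'I_N}.

Definition pl_var f : R := 'X_(enum_rank f).
Definition row_var f h : 'rV[R]_N := \row_j pl_var (replace_at f h j).

(** The coordinate [j] of the equation given by Cramer's rule for [f], where the
    vector [z] may itself have polynomial entries. *)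
Definition mem_poly (z : 'rV[R]_N) f j : R :=
  pl_var f * z 0 j - \sum_h z 0 (f h) * row_var f h 0 j.
(** The targets of the linear and bilinear maps are larger than the space that [W]
    lives in: the first [N'] coordinates have to vanish. *)
Definition mem_polys (z : 'rV[R]_(N' + N)) : seq R :=
  [seq z 0 (lshift N j) | j <- enum 'I_N'] ++
  [seq mem_poly (rsubmx z) u.1 u.2 | u <- enum {: {ffun 'I_d -> 'I_N} * 'I_N}].

Definition lin_var (M : 'M[k]_(N, N' + N)) f h : 'rV[R]_(N' + N) :=
  row_var f h *m map_mx (@mpolyC _ k) M.
Definition bil_var (C : 'I_N -> 'M[k]_(N, N' + N)) f h f' h' : 'rV[R]_(N' + N) :=
  \sum_i row_var f h 0 i *: lin_var (C i) f' h'.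

Definition pl_index : finType := ({ffun 'I_d -> 'I_N} * 'I_d)%type.
Definition closed_polys s (M : 'I_s -> 'M[k]_(N, N' + N))
    (C : 'I_N -> 'M[k]_(N, N' + N)) : seq R :=
  flatten [seq mem_polys (lin_var (M u.1) u.2.1 u.2.2) | u <- enum {: 'I_s * pl_index}] ++
  flatten [seq mem_polys (bil_var C u.1.1 u.1.2 u.2.1 u.2.2)
    | u <- enum {: pl_index * pl_index}].

Definition schubert_polys (Neg : pred 'I_N) (c : pred nat) : seq R :=
  [seq pl_var f | f <- enum {: {ffun 'I_d -> 'I_N}} & c #|[pred h | Neg (f h)]|].

Lemma pl_var_homog f : pl_var f \is 1.-homog.
Proof. by rewrite /pl_var dhomogX /= mdeg1. Qed.

Lemma row_var_homog f h j : row_var f h 0 j \is 1.-homog.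
Proof. by rewrite mxE pl_var_homog. Qed.

Lemma mem_polys_homog e (z : 'rV[R]_(N' + N)) : (forall j, z 0 j \is e.-homog) ->
  all (fun p => p \is homog mdeg) (mem_polys z).
Proof.
move=> hz; rewrite all_cat; apply/andP; split; apply/allP => p /mapP[u _ ->].
  by apply/homogP; exists e.
apply/homogP; exists e.+1; rewrite rpredB //.
  by apply: (dhomogM (pl_var_homog _)); rewrite mxE.
apply: rpred_sum => h _; rewrite mulrC.
by apply: (dhomogM (row_var_homog _ _ _)); rewrite mxE.
Qed.

Lemma lin_var_homog M f h j : lin_var M f h 0 j \is 1.-homog.
Proof.
rewrite mxE; apply: rpred_sum => i _; rewrite [map_mx _ _ _ _]mxE mulrC mul_mpolyC.
by rewrite rpredZ // row_var_homog.
Qed.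

Lemma bil_var_homog C f h f' h' j : bil_var C f h f' h' 0 j \is 2.-homog.
Proof.
rewrite summxE; apply: rpred_sum => i _; rewrite mxE.
exact: (dhomogM (row_var_homog _ _ _) (lin_var_homog _ _ _ _)).
Qed.

Lemma closed_polys_homog s M C : all (fun p => p \is homog mdeg) (@closed_polys s M C).
Proof.
rewrite all_cat; apply/andP; split; apply/all_flatten_enum => u.
  by apply: (@mem_polys_homog 1) => j; apply: lin_var_homog.
by apply: (@mem_polys_homog 2) => j; apply: bil_var_homog.
Qed.

Lemma schubert_polys_homog Neg c : all (fun p => p \is homog mdeg) (schubert_polys Neg c).
Proof.
by apply/allP => p /mapP[f _ ->]; apply/homogP; exists 1%N; apply: pl_var_homog.
Qed.
End Fixed_d.

Section Evaluation.
Variables (N' : nat) (K : fieldExtType k) (W : {vspace 'rV[K]_N}).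
Local Notation d := (\dim W).
Local Notation B := (vbasis_mx W).
Local Notation ev := (mmap (in_alg K) (pluecker (W := W))).
Implicit Types f : {ffun 'I_d -> 'I_N}.

Lemma ev_pl_var f : ev (pl_var f) = minor B f.
Proof.
rewrite mmapX mmap1U /pluecker enum_rankK /minor; congr (\det _).
by apply/matrixP => i j; rewrite !mxE.
Qed.

Lemma ev_row_var f h : map_mx ev (row_var f h) = exchange_row B f h.
Proof. by apply/rowP => j; rewrite !mxE ev_pl_var. Qed.

Lemma ev_mem_polys (z : 'rV[{mpoly k[pl_size N d]}]_(N' + N)) :
  all (fun p => ev p == 0) (mem_polys z) <->
  lsubmx (map_mx ev z) = 0 /\ rsubmx (map_mx ev z) \in W.
Proof.
have memE (y : 'rV[{mpoly k[pl_size N d]}]_N) f j : ev (mem_poly y f j) =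
    (minor B f *: map_mx ev y - \sum_h map_mx ev y 0 (f h) *: exchange_row B f h) 0 j.
  rewrite /mem_poly rmorphB /= rmorphM /= ev_pl_var rmorph_sum /=.
  rewrite [RHS]mxE [X in _ = X + _]mxE [X in _ = _ + X]mxE summxE [map_mx _ _ _ _]mxE.
  congr (_ - _); apply: eq_bigr => h _.
  by rewrite rmorphM /= [in RHS]mxE -ev_row_var [map_mx _ _ _ _]mxE [map_mx _ _ _ _]mxE.
rewrite all_cat; split=> [/andP[/all_map_enum zl /all_map_enum zr]|[zl zr]].
  split; first by apply/rowP => j; have /eqP := zl j; rewrite !mxE.
  apply/mem_cramer => f; apply/rowP => j.
  have /eqP := zr (f, j); rewrite memE map_rsubmx => /eqP.
  by rewrite !mxE subr_eq0 => /eqP.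
apply/andP; split; apply/all_map_enum.
  move=> j; by have /rowP/(_ j) := zl; rewrite !mxE => ->.
by case=> f j; rewrite memE map_rsubmx; have /mem_cramer-> := zr; rewrite subrr mxE.
Qed.

Lemma ev_lin_var (M : 'M[k]_(N, N' + N)) f h :
  map_mx ev (lin_var M f h) = exchange_row B f h *m map_mx (in_alg K) M.
Proof.
rewrite map_mxM ev_row_var; congr (_ *m _); apply/matrixP => i j.
by rewrite !mxE /= mmapC.
Qed.

Lemma ev_bil_var (C : 'I_N -> 'M[k]_(N, N' + N)) f h f' h' :
  map_mx ev (bil_var C f h f' h') =
  \sum_i exchange_row B f h 0 i *: (exchange_row B f' h' *m map_mx (in_alg K) (C i)).
Proof.
rewrite map_mx_sum; apply: eq_bigr => i _; rewrite map_mxZ ev_lin_var.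
by rewrite -(ev_row_var f h) [in RHS]mxE.
Qed.

Definition in_summand (z : 'rV[K]_(N' + N)) : Prop := lsubmx z = 0 /\ rsubmx z \in W.

Lemma in_summand_subspace : subspace in_summand.
Proof.
split=> [|a x y [x0 xW] [y0 yW]]; first by rewrite /in_summand !linear0 mem0v.
by rewrite /in_summand !linearP /= x0 y0 scaler0 addr0 memvD ?memvZ.
Qed.

(** The rows [exchange_row B f h] belong to [W] and span it, so it is enough to
    require stability on them. *)
Lemma ev_closed_polys s (M : 'I_s -> 'M[k]_(N, N' + N)) (C : 'I_N -> 'M[k]_(N, N' + N)) :
  all (fun p => ev p == 0) (closed_polys d M C) <->
  (forall i x, x \in W -> in_summand (x *m map_mx (in_alg K) (M i))) /\
  (forall x y, x \in W -> y \in W ->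
     in_summand (\sum_i x 0 i *: (y *m map_mx (in_alg K) (C i)))).
Proof.
rewrite all_cat; split=> [/andP[/all_flatten_enum HM /all_flatten_enum HC]|[HM HC]].
  split=> [i x|x y xW yW].
    move: x; apply: exchange_row_ind => [|f h].
      exact: (@subspace_preim _ _ _ (mulmxr (map_mx (in_alg K) (M i))) _ in_summand_subspace).
    by have /ev_mem_polys := HM (i, (f, h)); rewrite ev_lin_var.
  move: x xW; apply: exchange_row_ind => [|f h].
    split=> [|a x x' Hx Hx'].
      rewrite big1 => [|i _]; first exact: subspace0 in_summand_subspace.
      by rewrite mxE scale0r.
    under eq_bigr do rewrite !mxE scalerDl -scalerA.
    rewrite big_split -scaler_sumr /=; apply: subspaceD => //.
      exact: in_summand_subspace.
    by apply: subspaceZ => //; exact: in_summand_subspace.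
  move: y yW; apply: exchange_row_ind => [|f' h'].
    split=> [|a y y' Hy Hy'].
      rewrite big1 => [|i _]; first exact: subspace0 in_summand_subspace.
      by rewrite mul0mx scaler0.
    under eq_bigr do rewrite mulmxDl -scalemxAl scalerDr scalerA mulrC -scalerA.
    rewrite big_split -scaler_sumr /=; apply: subspaceD => //.
      exact: in_summand_subspace.
    by apply: subspaceZ => //; exact: in_summand_subspace.
  by have /ev_mem_polys := HC ((f, h), (f', h')); rewrite ev_bil_var.
apply/andP; split; apply/all_flatten_enum => u; apply/ev_mem_polys.
  by rewrite ev_lin_var; apply: HM; apply: exchange_row_mem.
by rewrite ev_bil_var; apply: HC; apply: exchange_row_mem.
Qed.
End Evaluation.

(** The condition on dimensions is split according to the largest [neg_count] [c] of a
    nonzero Pluecker coordinate: all coordinates with a larger count vanish, and one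
    with count [c] does not. By [dim_cap_coord_space] the intersection then has
    dimension [\dim W - c]. *)
Lemma gr_linear_conditions N' s (M : 'I_s -> 'M[k]_(N, N' + N))
    (C : 'I_N -> 'M[k]_(N, N' + N)) (Neg : pred 'I_N) (R : nat -> nat -> bool) :
  exists Z : gr_constructible k N, forall (K : fieldExtType k) (W : {vspace 'rV[K]_N}),
    gr_point Z W <->
    [/\ R (\dim W) (\dim (W :&: coord_space K Neg)),
      forall i x, x \in W -> in_summand W (x *m map_mx (in_alg K) (M i)) &
      forall x y, x \in W -> y \in W ->
        in_summand W (\sum_i x 0 i *: (y *m map_mx (in_alg K) (C i)))].
Proof.
pose piece d c : gr_piece k N d :=
  (closed_polys d M C ++ schubert_polys d Neg (fun c' => c < c')%N,
   schubert_polys d Neg (pred1 c)).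
pose pieces d := [seq piece d c | c <- iota 0 d.+1 & R d (d - c)%N].
have homog_pieces d P : P \in pieces d -> all (fun p => p \is homog mdeg) (P.1 ++ P.2).
  move=> /mapP[c _ ->]; rewrite all_cat; apply/andP; split; last first.
    exact: schubert_polys_homog.
  rewrite all_cat; apply/andP.
  by split; [exact: closed_polys_homog|exact: schubert_polys_homog].
exists (GrConstructible homog_pieces) => K W.
have schub (c : pred nat) (a : pred {mpoly k[pl_size N (\dim W)]}) :
    all a (schubert_polys (\dim W) Neg c) <->
    forall f : {ffun 'I_(\dim W) -> 'I_N}, c (neg_count Neg f) -> a (pl_var f).
  rewrite /schubert_polys; split=> [/allP ha f cf|ha].
    by apply: ha; apply: map_f; rewrite mem_filter mem_enum andbT.
  by apply/allP => p /mapP[f]; rewrite mem_filter => /andP[cf _] ->; exact: ha.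
pose ev := mmap (in_alg K) (pluecker (W := W)).
pose nz (f : {ffun 'I_(\dim W) -> 'I_N}) := minor (vbasis_mx W) f != 0.
have pieceP c :
    all (fun p => ev p == 0) (piece (\dim W) c).1 &&
      has (fun p => ev p != 0) (piece (\dim W) c).2 <->
    [/\ all (fun p => ev p == 0) (closed_polys (\dim W) M C),
      exists2 f, nz f & neg_count Neg f = c &
      forall f, nz f -> (neg_count Neg f <= c)%N].
  rewrite all_cat.
  split=> [/andP[/andP[cl /schub E] /hasP[p /mapP[f]]]|[cl [f nzf cf] fmax]].
    rewrite mem_filter => /andP[/eqP cf _] -> nzf; split=> //.
      by exists f => //; rewrite /nz -ev_pl_var.
    by move=> f'; rewrite /nz -ev_pl_var leqNgt; apply: contra => /E.
  rewrite cl /=; apply/andP; split.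
    apply/schub => f' cf'; rewrite /ev ev_pl_var; apply: contraTT cf' => nz'.
    by rewrite -leqNgt fmax.
  apply/hasP; exists (pl_var f); rewrite /ev ?ev_pl_var //.
  by apply: map_f; rewrite mem_filter mem_enum andbT -cf /=.
rewrite /gr_point /=; split=> [/hasP[P /mapP[c]]|[HR HM HC]].
  rewrite mem_filter => /andP[Rc _] -> /pieceP[/ev_closed_polys[HM HC] [f nzf cf] fmax].
  by split=> //; rewrite (dim_cap_coord_space nzf) cf.
have [f nzf fmax] := dim_cap_coord_spaceP Neg W.
apply/hasP; exists (piece (\dim W) (neg_count Neg f)).
  apply: map_f; rewrite mem_filter -(dim_cap_coord_space nzf fmax) HR.
  by rewrite mem_iota add0n ltnS neg_count_le.
apply/pieceP; split=> //; last by exists f.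
exact/ev_closed_polys.
Qed.
Lemma gr_empty : exists Z : gr_constructible k N,
  forall (K : fieldExtType k) (W : {vspace 'rV[K]_N}), ~~ gr_point Z W.
Proof.
have h d (P : gr_piece k N d) :
    P \in [::] -> all (fun p => p \is homog mdeg) (P.1 ++ P.2).
  by [].
by exists (GrConstructible h).
Qed.
End Polynomials.

(** * Extension of scalars *)

Section Tensor.
Variables (k : fieldType) (A : lieType k) (K : fieldExtType k).
Local Notation n := (\dim {:K}).
Local Notation e := (vbasis {:K}).
Implicit Types (x y : A) (P Q R : A -> Prop).
Local Notation t1 := (tens1 K).

Lemma tensDE (x y : tens A K) i : (x + y) i = x i + y i.
Proof. exact: ffunE. Qed.
Lemma tensNE (x : tens A K) i : (- x) i = - x i.
Proof. exact: ffunE. Qed.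
Lemma tens0E i : (0 : tens A K) i = 0.
Proof. exact: ffunE. Qed.
Lemma tens_sumE I (r : seq I) (P : pred I) (G : I -> tens A K) i :
  (\sum_(j <- r | P j) G j) i = \sum_(j <- r | P j) G j i.
Proof.
by elim/big_rec2: _ => [|j y z _ <-]; [exact: tens0E|exact: tensDE].
Qed.
Lemma tensZE (a : K) (x : tens A K) i :
  (a *: x) i = \sum_(j < n) coord e i (a * e`_j) *: x j.
Proof. exact: ffunE. Qed.
Lemma tens_lieE (x y : tens A K) l : lie x y l =
  \sum_(i < n) \sum_(j < n) coord e l (e`_i * e`_j) *: lie (x i) (y j).
Proof. exact: ffunE. Qed.

Lemma scale_tens1E (a : K) x i : (a *: t1 x) i = coord e i a *: x.
Proof.
rewrite tensZE -[in RHS](mulr1 a) tens_coordM scaler_suml.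
by apply: eq_bigr => j _; rewrite ffunE scalerA.
Qed.

Lemma tens1_linear (a : k) x y : t1 (a *: x + y) = a%:A *: t1 x + t1 y.
Proof.
apply/ffunP => i; rewrite tensDE scale_tens1E !ffunE scalerDr.
by rewrite [coord _ _ (a *: 1)]linearZ /= !scalerA mulrC.
Qed.

Lemma tens1_0 : t1 (0 : A) = 0.
Proof. by apply/ffunP => i; rewrite ffunE scaler0 tens0E. Qed.
Lemma tens1D x y : t1 (x + y) = t1 x + t1 y.
Proof. by have := tens1_linear 1 x y; rewrite !scale1r. Qed.
Lemma tens1Z a x : t1 (a *: x) = a%:A *: t1 x.
Proof. by have := tens1_linear a x 0; rewrite tens1_0 !addr0. Qed.
Lemma tens1N x : t1 (- x) = - t1 x.
Proof. by apply: (addIr (t1 x)); rewrite -tens1D !addNr tens1_0. Qed.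
Lemma tens1B x y : t1 (x - y) = t1 x - t1 y.
Proof. by rewrite tens1D tens1N. Qed.
Lemma tens1_sum I (r : seq I) (P : pred I) (G : I -> A) :
  t1 (\sum_(j <- r | P j) G j) = \sum_(j <- r | P j) t1 (G j).
Proof.
by elim/big_rec2: _ => [|j y z _ <-]; [exact: tens1_0|exact: tens1D].
Qed.

Lemma tens1_lie x y : lie (t1 x) (t1 y) = t1 (lie x y).
Proof.
apply/ffunP => l; rewrite tens_lieE [RHS]ffunE.
have -> : coord e l 1 = \sum_(i < n) \sum_(j < n)
    coord e i 1 * (coord e l (e`_i * e`_j) * coord e j 1).
  rewrite -[1 in LHS](mulr1 1) tens_coordM; apply: eq_bigr => i _.
  by rewrite -mulr_sumr -tens_coordM mul1r mulr1 mulrC.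
rewrite scaler_suml; apply: eq_bigr => i _; rewrite scaler_suml; apply: eq_bigr => j _.
by rewrite !ffunE lieZl lieZr !scalerA mulrCA mulrA (mulrC (coord e i 1)).
Qed.

Lemma tens_basis_sum (x : tens A K) : x = \sum_(i < n) e`_i *: t1 (x i).
Proof.
have fe := basis_free (vbasisP {:K}); apply/ffunP => l.
rewrite tens_sumE (bigD1 l) //= big1 ?addr0 => [|i /negPf ne].
  by rewrite scale_tens1E coord_free // eqxx scale1r.
by rewrite scale_tens1E coord_free // ne scale0r.
Qed.

Lemma tens_sub_subspace P : subspace P -> subspace (tens_sub P : tens A K -> Prop).
Proof.
move=> sP; split=> [i|a x y Px Py i]; first by rewrite tens0E; exact: subspace0.
rewrite tensDE tensZE; apply: subspaceD => //.
by apply: subspace_sum => // j _; apply: subspaceZ.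
Qed.

Lemma tens_sub_tens1 P x : subspace P -> P x -> tens_sub P (t1 x).
Proof. by move=> sP Px i; rewrite ffunE; exact: subspaceZ. Qed.

Lemma tens_sub_tens1_inv P x :
  subspace P -> tens_sub P (t1 x) -> P x.
Proof.
move=> sP Px; have [/existsP[i ci]|] := boolP [exists i, coord e i 1 != 0].
  have := Px i; rewrite ffunE => /(subspaceZ (coord e i 1)^-1 sP).
  by rewrite scalerK.
rewrite negb_exists => /forallP c0; case/eqP: (oner_neq0 K).
rewrite [LHS](tens_coord (1 : K)) big1 // => i _.
by have := c0 i; rewrite negbK => /eqP->; rewrite scale0r.
Qed.

Lemma tens_subS P Q (x : tens A K) :
  (forall y, P y -> Q y) -> tens_sub P x -> tens_sub Q x.
Proof. by move=> PQ Px i; apply: PQ. Qed.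

Lemma tens_sub_lie P Q R (x y : tens A K) : subspace R ->
  (forall u v, P u -> Q v -> R (lie u v)) ->
  tens_sub P x -> tens_sub Q y -> tens_sub R (lie x y).
Proof.
move=> sR PQR Px Qy l; rewrite tens_lieE; apply: subspace_sum => // i _.
by apply: subspace_sum => // j _; apply: subspaceZ => //; apply: PQR.
Qed.

Lemma tens_sub_ind P (H : tens A K -> Prop) : subspace H ->
  (forall x, P x -> H (t1 x)) -> forall x : tens A K, tens_sub P x -> H x.
Proof.
move=> sH PH x Px; rewrite [x]tens_basis_sum; apply: subspace_sum => // i _.
by apply: subspaceZ => //; apply: PH.
Qed.

Lemma tens_basis_mod P Q N (b : 'I_N -> A) : subspace P -> subspace Q ->
  basis_mod P Q b -> basis_mod (tens_sub P) (tens_sub Q) (t1 \o b).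
Proof.
move=> sP sQ bb; have sumE (a : 'I_N -> K) i :
    (\sum_j a j *: t1 (b j)) i = \sum_j coord e i (a j) *: b j.
  by rewrite tens_sumE; apply: eq_bigr => j _; rewrite scale_tens1E.
apply: basis_mod_intro; first exact: tens_sub_subspace.
- by move=> i; apply: tens_sub_tens1 => //; apply: bb.1.
- move=> x Px; have /fin_all_exists[a Ha] i := basis_mod_spanning bb (Px i).
  exists (fun j => \sum_(i < n) a i j *: e`_i) => i.
  rewrite tensDE tensNE sumE; move: (Ha i); congr (Q (_ - _)).
  apply: eq_bigr => j _; congr (_ *: _); rewrite coord_sum_free //.
  exact: basis_free (vbasisP _).
move=> a Ha j; rewrite [LHS](tens_coord (a j)) big1 // => i _.
have := Ha i; rewrite sumE => /(basis_mod_free sP sQ bb)/(_ j) ->.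
by rewrite scale0r.
Qed.
End Tensor.

(** * Subspaces between [F] and [U] *)

Section Lift.
Variables (k : fieldType) (A : lieType k) (K : fieldExtType k).

Definition comb N (b : 'I_N -> A) (v : 'rV[K]_N) : tens A K :=
  \sum_i v 0 i *: tens1 K (b i).

Lemma comb_is_linear N (b : 'I_N -> A) : linear (comb b).
Proof.
move=> a u v; rewrite /comb scaler_sumr -big_split; apply: eq_bigr => i _ /=.
by rewrite !mxE scalerDl scalerA.
Qed.
HB.instance Definition _ N (b : 'I_N -> A) :=
  GRing.isLinear.Build K 'rV[K]_N (tens A K) *:%R (comb b) (comb_is_linear b).

Variables (U F : A -> Prop) (N : nat) (b : 'I_N -> A).
Hypotheses (sU : subspace U) (sF : subspace F) (FU : forall x, F x -> U x).
Hypothesis bU : basis_mod U F b.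
Implicit Types (W : {vspace 'rV[K]_N}) (x y : tens A K).
Let sFK : subspace (tens_sub F : tens A K -> Prop) := tens_sub_subspace K sF.
Let sUK : subspace (tens_sub U : tens A K -> Prop) := tens_sub_subspace K sU.
Let bUK : basis_mod (tens_sub U) (tens_sub F) (tens1 K \o b) :=
  tens_basis_mod K sU sF bU.

Definition preimage_of W x := exists2 v, v \in W & tens_sub F (x - comb b v).

Lemma preimage_subspace W : subspace (preimage_of W).
Proof.
split=> [|a x y [u uW Hu] [v vW Hv]].
  by exists 0; rewrite ?mem0v // linear0 subrr; exact: subspace0.
exists (a *: u + v); first by rewrite memvD ?memvZ.
rewrite linearP opprD addrACA -scalerBr; apply: (subspaceD sFK) Hv.
exact: (subspaceZ _ sFK).
Qed.

Lemma sub_preimage W x : tens_sub F x -> preimage_of W x.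
Proof. by move=> Fx; exists 0; rewrite ?mem0v // linear0 subr0. Qed.

Lemma comb_sub v : tens_sub U (comb b v).
Proof.
apply: (subspace_sum _ sUK) => i _; apply: (subspaceZ _ sUK).
by apply: tens_sub_tens1 => //; apply: bU.1.
Qed.

Lemma preimage_sub W x : preimage_of W x -> tens_sub U x.
Proof.
case=> v _ Fv; apply: (subspace_eqmod sUK _ (comb_sub v)).
exact: tens_subS Fv.
Qed.

Lemma comb_inj v : tens_sub F (comb b v) -> v = 0.
Proof. by move=> /(basis_mod_free sUK sFK bUK) v0; apply/rowP => i; rewrite v0 mxE. Qed.

Lemma preimage_comb W v : preimage_of W (comb b v) <-> v \in W.
Proof.
split=> [[u uW]|vW]; last by exists v => //; rewrite subrr; exact: subspace0.
by rewrite -linearB /= => /comb_inj/eqP; rewrite subr_eq0 => /eqP->.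
Qed.

Lemma preimage_eqmod W x y : tens_sub F (x - y) -> preimage_of W y -> preimage_of W x.
Proof.
move=> Fxy; apply: (subspace_eqmod (preimage_subspace W)).
exact: sub_preimage.
Qed.

Lemma comb_surj x : tens_sub U x -> exists v, tens_sub F (x - comb b v).
Proof.
case/(basis_mod_spanning bUK) => a Fa; exists (\row_i a i).
by move: Fa; congr (tens_sub F (_ - _)); apply: eq_bigr => i _; rewrite mxE.
Qed.

Lemma preimage_fullv x : preimage_of fullv x <-> tens_sub U x.
Proof.
split=> [|/comb_surj[v Fv]]; first exact: preimage_sub.
by exists v; rewrite ?memvf.
Qed.

Lemma preimageP (H : tens A K -> Prop) : subspace H ->
  (forall x, tens_sub F x -> H x) -> (forall x, H x -> tens_sub U x) ->
  exists W, forall x, H x <-> preimage_of W x.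
Proof.
move=> sH FH HU; have [W WP] := vspace_of_subspace (@subspace_preim _ _ _ (comb b) _ sH).
exists W => x; split=> [Hx|[v /WP Hv Fv]].
  have [v Fv] := comb_surj (HU x Hx); exists v => //; apply/WP.
  by apply: (subspace_eqmod sH _ Hx); apply: FH; exact: (subspace_eqmod_sym sFK).
by apply: (subspace_eqmod sH _ Hv); exact: FH.
Qed.

(** A basis of a complement of [W1 :&: W2] in [W1] lifts to a basis modulo
    [preimage_of W2]; the converse is the uniqueness of codimension. *)
Lemma codim_preimage W1 W2 n :
  codim (preimage_of W1) (preimage_of W2) n <-> n = (\dim W1 - \dim (W1 :&: W2))%N.
Proof.
suff c : codim (preimage_of W1) (preimage_of W2) (\dim (W1 :\: W2)).
  have -> : (\dim W1 - \dim (W1 :&: W2))%N = \dim (W1 :\: W2).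
    by rewrite -(dimv_cap_compl W1 W2) addKn.
  split=> [c'|->//].
  by apply: codim_uniq c' c; exact: preimage_subspace.
pose X := vbasis (W1 :\: W2).
have sumE (a : 'I_(\dim (W1 :\: W2)) -> K) :
    \sum_i a i *: comb b X`_i = comb b (\sum_i a i *: X`_i).
  by rewrite linear_sum; apply: eq_bigr => i _; rewrite linearZ.
have XW i : X`_(i : 'I_(\dim (W1 :\: W2))) \in (W1 :\: W2)%VS.
  by rewrite vbasis_mem // mem_nth // size_tuple.
have sub := subvP (diffvSl W1 W2).
exists (fun i => comb b X`_i); apply: basis_mod_intro; first exact: preimage_subspace.
- by move=> i; apply/preimage_comb/sub.
- move=> x [v vW1]; have : v \in (W1 :\: W2 + W1 :&: W2)%VS by rewrite addv_diff_cap.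
  case/memv_addP => v1 v1D [v2].
  rewrite memv_cap => /andP[_ v2W ev] Fx.
  exists (fun i => coord X i v1); rewrite sumE -coord_vbasis //.
  by exists v2 => //; rewrite -addrA -opprD -linearD -ev.
move=> a; rewrite sumE => /preimage_comb aW2.
have aD : \sum_i a i *: X`_i \in (W1 :\: W2)%VS by apply: memv_suml => i _; rewrite memvZ.
have : \sum_i a i *: X`_i \in ((W1 :\: W2) :&: W2)%VS by rewrite memv_cap aD aW2.
rewrite capv_diff memv0 => /eqP.
by have /freeP fr := basis_free (vbasisP (W1 :\: W2)); exact: fr.
Qed.
End Lift.

(** * The bracket in coordinates *)

Section StructureConstants.
Variables (k : fieldType) (A : lieType k) (V U F : A -> Prop).
Variables (N' N : nat) (b' : 'I_N' -> A) (b : 'I_N -> A).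
Hypotheses (sV : subspace V) (sU : subspace U) (sF : subspace F).
Hypotheses (FU : forall x, F x -> U x).
Hypotheses (bV : basis_mod V U b') (bU : basis_mod U F b).

(** Brackets of elements of [U] leave [U]: they lie in the larger space [V], for which
    [b'] followed by [b] is a basis modulo [F]. *)
Definition comb_above (K : fieldExtType k) (z : 'rV[K]_(N' + N)) : tens A K :=
  comb b' (lsubmx z) + comb b (rsubmx z).

Lemma comb_above_is_linear (K : fieldExtType k) : linear (@comb_above K).
Proof.
move=> a u v; rewrite /comb_above !linearP scalerDr.
by rewrite -!addrA; congr (_ + _); rewrite addrCA.
Qed.
HB.instance Definition _ (K : fieldExtType k) :=
  GRing.isLinear.Build K 'rV[K]_(N' + N) (tens A K) *:%R
  (@comb_above K) (@comb_above_is_linear K).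

Lemma preimage_comb_above (K : fieldExtType k) (W : {vspace 'rV[K]_N}) z :
  preimage_of F b W (comb_above z) <-> in_summand W z.
Proof.
split=> [Hz|[z0 zW]]; last first.
  by rewrite /comb_above z0 linear0 add0r; apply/(preimage_comb sU sF bU).
have z0 : lsubmx z = 0.
  apply: (comb_inj sV sU bV); have := preimage_sub sU FU bU Hz.
  rewrite /comb_above addrC; apply: subspace_addl; first exact: tens_sub_subspace.
  exact: comb_sub sU bU _.
split=> //; move: Hz; rewrite /comb_above z0 linear0 add0r.
by move/(preimage_comb sU sF bU).
Qed.

(** The matrix has entries in [k] and serves all extensions [K] at once. *)
Lemma structure_mx y : (forall x, U x -> V (lie y x)) ->
  exists M : 'M[k]_(N, N' + N), forall (K : fieldExtType k) (v : 'rV[K]_N),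
    tens_sub F (lie (tens1 K y) (comb b v) - comb_above (v *m map_mx (in_alg K) M)).
Proof.
move=> yUV.
have ex j : exists z : 'rV[k]_(N' + N),
    F (lie y (b j) - (\sum_i lsubmx z 0 i *: b' i + \sum_i rsubmx z 0 i *: b i)).
  have [a Ua] := basis_mod_spanning bV (yUV _ (bU.1 j)).
  have [c Fc] := basis_mod_spanning bU Ua.
  exists (row_mx (\row_i a i) (\row_i c i)); rewrite row_mxKl row_mxKr.
  have rowE n (u : 'I_n -> k) (w : 'I_n -> A) :
      \sum_i (\row_i u i) 0 i *: w i = \sum_i u i *: w i.
    by apply: eq_bigr => i _; rewrite mxE.
  by rewrite !rowE opprD addrA.
have [z zE] := fin_all_exists ex.
exists (\matrix_j z j) => K v; rewrite mulmx_sum_row [comb b v]/comb lie_sumr.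
rewrite [comb_above (\sum_(_ < _) _)]linear_sum /= -sumrB.
apply: (subspace_sum _ (tens_sub_subspace K sF)) => j _.
rewrite lieZr linearZ /= -scalerBr; apply: (subspaceZ _ (tens_sub_subspace K sF)).
rewrite -map_row rowK tens1_lie.
suff -> : comb_above (map_mx (in_alg K) (z j)) =
    tens1 K (\sum_i lsubmx (z j) 0 i *: b' i + \sum_i rsubmx (z j) 0 i *: b i).
  by rewrite -tens1B; apply: tens_sub_tens1.
rewrite tens1D !tens1_sum /comb_above /comb; congr (_ + _); apply: eq_bigr => i _.
  by rewrite tens1Z !mxE.
by rewrite tens1Z !mxE.
Qed.

Lemma gr_bracket_conditions s (y : 'I_s -> A) (Neg : pred 'I_N) (R : nat -> nat -> bool) :
  (forall i x, U x -> V (lie (y i) x)) -> (forall x x', U x -> U x' -> V (lie x x')) ->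
  exists Z : gr_constructible k N, forall (K : fieldExtType k) (W : {vspace 'rV[K]_N}),
    gr_point Z W <->
    [/\ R (\dim W) (\dim (W :&: coord_space K Neg)),
      forall i v, v \in W -> preimage_of F b W (lie (tens1 K (y i)) (comb b v)) &
      forall u v, u \in W -> v \in W -> preimage_of F b W (lie (comb b u) (comb b v))].
Proof.
move=> yUV UUV; have [M HM] := fin_all_exists (fun i => structure_mx (yUV i)).
have [C HC] := fin_all_exists (fun i => structure_mx (fun x => UUV _ x (bU.1 i))).
have [Z ZP] := gr_linear_conditions M C Neg R; exists Z => K W.
have sFK := tens_sub_subspace K sF.
have linE i v : preimage_of F b W (lie (tens1 K (y i)) (comb b v)) <->
    in_summand W (v *m map_mx (in_alg K) (M i)).
  apply: iff_trans (preimage_comb_above _ _); split; apply: preimage_eqmod => //.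
  exact: (subspace_eqmod_sym sFK).
have bilE u v : preimage_of F b W (lie (comb b u) (comb b v)) <->
    in_summand W (\sum_i u 0 i *: (v *m map_mx (in_alg K) (C i))).
  have h : tens_sub F (lie (comb b u) (comb b v) -
      comb_above (\sum_i u 0 i *: (v *m map_mx (in_alg K) (C i)))).
    rewrite [comb_above (\sum_(_ < _) _)]linear_sum [comb b u]/comb lie_suml.
    rewrite -sumrB; apply: (subspace_sum _ sFK) => i _.
    by rewrite lieZl linearZ -scalerBr; apply: (subspaceZ _ sFK).
  apply: iff_trans (preimage_comb_above _ _); split; apply: preimage_eqmod => //.
  exact: (subspace_eqmod_sym sFK).
apply: iff_trans (ZP K W) _; split=> [][HR HM' HC']; split=> //.
- by move=> i v /(HM' i)/linE.
- by move=> u v uW vW; apply/bilE/HC'.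
- by move=> i v /(HM' i)/linE.
by move=> u v uW vW; apply/bilE/HC'.
Qed.
End StructureConstants.

(** * Subalgebras of finite codimension in a filtered algebra *)

Section FullDegrees.
Variables (k : fieldType) (A : lieType k) (F : nat -> A -> Prop) (K : fieldExtType k).
Variables (H : tens A K -> Prop).
Hypotheses (sF : forall i, subspace (F i)) (sH : subspace H).
Hypothesis FS : forall i x, F i.+1 x -> F i x.
Let sFK i : subspace (tens_sub (F i) : tens A K -> Prop) := tens_sub_subspace K (sF i).

Definition full_mod i x := exists2 y : tens A K, tens_sub (F i.+1) y & H (x - y).
Definition full_degree i := forall x : tens A K, tens_sub (F i) x -> full_mod i x.

Lemma filt_le i j x : (i <= j)%N -> F j x -> F i x.
Proof.
move=> /subnKC <-; elim: (j - i)%N => [|c IH]; first by rewrite addn0.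
by rewrite addnS => /FS/IH.
Qed.

Lemma full_mod_subspace i : subspace (full_mod i).
Proof.
split=> [|a x y [u Fu Hu] [v Fv Hv]].
  by exists 0; [exact: subspace0|rewrite subrr; exact: subspace0].
exists (a *: u + v); first exact: (sFK _).2.
by rewrite opprD addrACA -scalerBr; apply: sH.2.
Qed.

(** In a degree that is not full there is an element outside [H + F i.+1]. Elements
    chosen in distinct such degrees are independent modulo [H]: in a relation, the term
    of least degree would be a combination of the others modulo [H]. *)
Lemma full_degree_among n (f : 'I_n.+1 -> nat) :
  codim (tens_sub (F 0)) H n -> injective f -> exists t, full_degree (f t).
Proof.
move=> cn inj_f; apply: NNPP => nfull.
have bad t : exists x : tens A K, tens_sub (F (f t)) x /\ ~ full_mod (f t) x.
  apply: NNPP => nx; apply: nfull; exists t => x Fx; apply: NNPP => nf.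
  by apply: nx; exists x.
have [x xP] := fin_all_exists bad.
have [|u [t0 ut0] Hu] := codim_dependent sH cn (ltnSn n) (x := x).
  by move=> t; apply: tens_subS (xP t).1 => y; exact: filt_le.
case: (@arg_minnP _ t0 (fun t => u t != 0) f ut0) => t ut tmin.
apply: (xP t).2; exists (- \sum_(t' | t' != t) ((u t)^-1 * u t') *: x t').
  (* by minimality of [t], the other terms that occur have larger degree *)
  apply: (subspaceN (sFK _)); apply: (subspace_sum _ (sFK _)) => t' ne.
  have [->|ut'] := eqVneq (u t') 0; first by rewrite mulr0 scale0r; exact: subspace0.
  apply: (subspaceZ _ (sFK _)); apply: tens_subS (xP t').1 => y; apply: filt_le.
  by rewrite ltn_neqAle tmin // andbT eq_sym inj_eq.
have := subspaceZ (u t)^-1 sH Hu.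
rewrite (bigD1 t) //= scalerDr scalerA mulVf // scale1r opprK.
by rewrite scaler_sumr; congr (H (_ + _)); apply: eq_bigr => t' _; rewrite scalerA.
Qed.

(** Downward induction from [F j], one degree at a time. *)
Lemma full_degrees_sub l j : (forall i, (l <= i)%N -> full_degree i) ->
  (forall x, tens_sub (F j) x -> H x) -> forall x, tens_sub (F l) x -> H x.
Proof.
move=> full Fj; have [jl|/ltnW/subnKC e] := leqP j l.
  by move=> x Fx; apply: Fj; apply: tens_subS Fx => y; exact: filt_le.
suff main c : forall i, (l <= i)%N -> (i + c = j)%N -> forall x, tens_sub (F i) x -> H x.
  exact: main e.
elim: c => [|c IH] i li ij; first by rewrite addn0 in ij; rewrite ij.
move=> x /(full _ li)[y Fy Hxy]; apply: (subspace_eqmod sH Hxy).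
by apply: (IH i.+1) Fy; rewrite ?addSnnS // (leq_trans li).
Qed.

Hypothesis F_lie : forall i j x y, F i x -> F j y -> F (i + j) (lie x y).
Hypothesis H_lie : forall x y, H x -> H y -> H (lie x y).

Lemma full_mod_lie p r (x y : tens A K) : full_degree p -> full_degree r ->
  tens_sub (F p) x -> tens_sub (F r) y -> full_mod (p + r) (lie x y).
Proof.
move=> fp fr Fx Fy; have [x' Fx' Hx] := fp x Fx; have [y' Fy' Hy] := fr y Fy.
have FlK i j (u v : tens A K) : tens_sub (F i) u -> tens_sub (F j) v ->
    tens_sub (F (i + j)) (lie u v).
  by apply: tens_sub_lie => // ? ?; exact: F_lie.
have e : lie x y - lie (x - x') (y - y') = lie x' (y - y') + lie x y'.
  by rewrite lieDl lieNl [lie x (y - y')]linearB /= opprD opprK addrA subKr addrC.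
exists (lie x y - lie (x - x') (y - y')); last by rewrite opprB addrC subrK; exact: H_lie.
rewrite e; apply: (subspaceD (sFK _)); last by rewrite -addnS; exact: FlK.
rewrite -addSn; apply: FlK => //; apply: (subspaceB (sFK _)) => //.
by apply: tens_subS Fy' => ?; exact: FS.
Qed.

(** Among the [n.+1 ^ 2] candidates, cut into [n.+1] blocks of [n.+1], each block has a
    [t] for which [r + s * t] is full. This leaves [n.+1] distinct values
    [N - (r + s * t)], one of which is full as well. *)
Lemma full_degree_pair n s r N : codim (tens_sub (F 0)) H n -> (0 < s)%N ->
  (r + s * n.+1 ^ 2 <= N)%N ->
  exists t, [/\ (r + s * t <= N)%N, full_degree (r + s * t) &
    full_degree (N - (r + s * t))].
Proof.
move=> cn s0 leN.
have exc (u : 'I_n.+1) : exists c : 'I_n.+1, full_degree (r + s * (u * n.+1 + c)).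
  pose f (c : 'I_n.+1) := (r + s * (u * n.+1 + c))%N.
  apply: (full_degree_among (f := f)) => // c c'.
  by move=> /addnI/eqP; rewrite eqn_pmul2l // eqn_add2l => /eqP/val_inj.
have [c cP] := fin_all_exists exc.
pose t (u : 'I_n.+1) := (u * n.+1 + c u)%N.
have tlt (u : 'I_n.+1) : (r + s * t u <= N)%N.
  apply: leq_trans leN; rewrite leq_add2l leq_pmul2l // /t -mulnn.
  apply: (@leq_trans (u * n.+1 + n.+1)); first by rewrite leq_add2l ltnW.
  by rewrite -mulSnr leq_pmul2r.
have [|u fu] := full_degree_among (f := fun u : 'I_n.+1 => (N - (r + s * t u))%N) cn.
- move=> u u' e; have : (r + s * t u = r + s * t u')%N.
    by rewrite -(subKn (tlt u)) e subKn.
  move=> /addnI/eqP; rewrite eqn_pmul2l // => /eqP/(congr1 (fun a => (a %/ n.+1)%N)).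
  by rewrite !divnMDl // !divn_small ?addn0 // => /val_inj.
by exists (t u); split; [exact: tlt|exact: cP|exact: fu].
Qed.
End FullDegrees.

(** * Gradings of simple Lie algebras *)

Section SimpleGraded.
Variables (k : fieldType) (g : fdLieType k) (al : 'End(g)) (m : nat) (eps : k).
Hypotheses (k0 : [pchar k] =i pred0) (gs : simple_lie g) (alP : lie_automorphism al)
  (alm : has_order al m) (epsP : m.-primitive_root eps).

(** The subspace generated by the brackets is a nonzero ideal. Perfectness is phrased
    as an induction principle because that is how it is applied. *)
Lemma simple_perfect (P : g -> Prop) : subspace P ->
  (forall a b, P (lie a b)) -> forall c, P c.
Proof.
move=> sP PP.
(* the intersection of all subspaces that contain the brackets *)
have sS : subspace (fun c => forall Q : g -> Prop,
    subspace Q -> (forall a b, Q (lie a b)) -> Q c).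
  split=> [Q sQ _|a x y Px Py Q sQ QQ]; first exact: subspace0.
  by apply: sQ.2; [exact: Px|exact: Py].
have [X XP] := vspace_of_subspace sS.
have Xlie a b : lie a b \in X by apply/XP => Q _; exact.
case: (gs.2 X (fun x y _ => Xlie x y)) => X0 c.
  have [a [b nab]] := gs.1; have := Xlie a b; rewrite X0 memv0 => /eqP.
  by move/nab.
by have /XP/(_ P sP PP) : c \in X by rewrite X0 memvf.
Qed.

Lemma eps_neq0 : eps != 0.
Proof.
apply/eqP => e0; have := prim_expr_order epsP.
by rewrite e0 expr0n gtn_eqF ?(prim_order_gt0 epsP) //= => /esym/eqP; rewrite oner_eq0.
Qed.

Lemma natr_m_neq0 : m%:R != 0 :> k.
Proof. by rewrite ((pcharf0P k).1 k0) -lt0n (prim_order_gt0 epsP). Qed.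

(** The average over the powers of the automorphism, twisted by [z]: the projection
    onto the eigenspace of [z] when [z ^+ m = 1]. *)
Definition eigen_proj (z : k) (c : g) : g :=
  m%:R^-1 *: \sum_(s < m) z^-1 ^+ s *: iter s al c.

Lemma iter_linear s a x y : iter s al (a *: x + y) = a *: iter s al x + iter s al y.
Proof. by elim: s => //= s ->; rewrite linearP. Qed.

Lemma eigen_proj_is_linear z : linear (eigen_proj z).
Proof.
move=> a x y; rewrite /eigen_proj scalerA mulrC -scalerA -scalerDr; congr (_ *: _).
rewrite scaler_sumr -big_split; apply: eq_bigr => s _ /=.
by rewrite iter_linear scalerDr !scalerA mulrC.
Qed.
HB.instance Definition _ z :=
  GRing.isLinear.Build k g g *:%R (eigen_proj z) (eigen_proj_is_linear z).

Lemma expr_unity_neq0 (z : k) : z ^+ m = 1 -> z != 0.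
Proof.
move=> zm; apply/eqP => z0; move/eqP: zm.
by rewrite z0 expr0n gtn_eqF ?(prim_order_gt0 epsP) //= eq_sym oner_eq0.
Qed.

Lemma eigen_projE z c : z ^+ m = 1 -> al (eigen_proj z c) = z *: eigen_proj z c.
Proof.
move=> zm; have z0 := expr_unity_neq0 zm; have [m0 itm _] := alm.
pose G s := z^-1 ^+ s *: iter s al c.
have Gm : G m = G 0%N by rewrite /G itm exprVn zm invr1 expr0.
rewrite /eigen_proj linearZ /= scalerA mulrC -scalerA; congr (_ *: _).
rewrite linear_sum scaler_sumr; apply: etrans (_ : \sum_(s < m) z *: G s.+1 = _).
  apply: eq_bigr => s _; rewrite linearZ /= /G exprS scalerA mulrA.
  by rewrite mulfV // mul1r.
rewrite -!scaler_sumr; congr (_ *: _).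
case: m m0 Gm => // n _ Gm; rewrite big_ord_recr big_ord_recl /= Gm addrC.
by congr (_ + _); apply: eq_bigr => i _; rewrite lift0.
Qed.

Lemma sum_unity (w : k) : w ^+ m = 1 -> \sum_(s < m) w ^+ s = (w == 1)%:R * m%:R.
Proof.
move=> wm; case: eqP => [->|/eqP w1].
  by under eq_bigr do rewrite expr1n; rewrite sumr_const card_ord mul1r.
apply/eqP; rewrite mul0r -(mulrI_eq0 _ (mulfI (_ : w - 1 != 0))) ?subr_eq0 //.
by rewrite -subrX1 wm subrr.
Qed.

Lemma eigen_proj_eigen z w c : z ^+ m = 1 -> w ^+ m = 1 -> al c = w *: c ->
  eigen_proj z c = (z == w)%:R *: c.
Proof.
move=> zm wm ac; have it s : iter s al c = w ^+ s *: c.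
  elim: s => [|s IH]; first by rewrite expr0 scale1r.
  by rewrite iterS IH linearZ /= ac scalerA exprSr.
rewrite /eigen_proj; under eq_bigr do rewrite it scalerA -exprMn.
rewrite -scaler_suml sum_unity; last by rewrite exprMn exprVn zm wm invr1 mulr1.
rewrite scalerA mulrCA mulVf ?natr_m_neq0 // mulr1; congr (_%:R *: _).
by rewrite -(inj_eq (mulfI (expr_unity_neq0 zm))) mulVKf ?expr_unity_neq0 // mulr1 eq_sym.
Qed.

Lemma eps_unity j : (eps ^+ j) ^+ m = 1.
Proof. by rewrite exprAC (prim_expr_order epsP) expr1n. Qed.

Lemma sum_eigen_proj c : c = \sum_(j < m) eigen_proj (eps ^+ j) c.
Proof.
rewrite -scaler_sumr exchange_big /=.
rewrite (eq_bigr (fun s : 'I_m => ((s : nat) == 0%N)%:R * m%:R *: iter s al c)) => [|s _].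
  have m0 := prim_order_gt0 epsP.
  rewrite (bigD1 (Ordinal m0)) //= big1 ?addr0 => [|s ne].
    by rewrite mul1r scalerA mulVf ?natr_m_neq0 ?scale1r.
  by rewrite -val_eqE /= in ne; rewrite (negPf ne) mul0r scale0r.
rewrite -scaler_suml; congr (_ *: _).
rewrite (eq_bigr (fun j : 'I_m => (eps ^+ s)^-1 ^+ j)) => [|j _].
  rewrite sum_unity ?exprVn ?eps_unity ?invr1 // invr_eq1.
  by rewrite -(expr0 eps) (eq_prim_root_expr epsP) modn_small // mod0n.
by rewrite -!exprVn exprAC.
Qed.

Lemma eigen_ind (Q : g -> Prop) : subspace Q ->
  (forall r c, al c = eps ^+ r *: c -> Q c) -> forall c, Q c.
Proof.
move=> sQ QE c; rewrite [c]sum_eigen_proj; apply: subspace_sum => // j _.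
by apply: (QE j); apply: eigen_projE; exact: eps_unity.
Qed.

Lemma lie_eigen (z w : k) a b : al a = z *: a -> al b = w *: b ->
  al (lie a b) = (z * w) *: lie a b.
Proof. by move=> ea eb; rewrite alP.2 ea eb lieZl lieZr scalerA. Qed.

Lemma lie_subspacel (Q : g -> Prop) b : subspace Q -> subspace (fun a => Q (lie a b)).
Proof.
move=> sQ; split=> [|s x y Qx Qy]; first by rewrite lie0l; exact: subspace0.
by rewrite lieDl lieZl; apply: sQ.2.
Qed.
Lemma lie_subspacer (Q : g -> Prop) a : subspace Q -> subspace (fun b => Q (lie a b)).
Proof. exact: (@subspace_preim _ _ _ (lie a)). Qed.

(** Project a sum of brackets to the eigenspace of [z]. By [eigen_ind] the arguments
    of the brackets may be taken to be eigenvectors, and then the projection keeps a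
    bracket if its eigenvalues multiply to [z] and kills it otherwise. *)
Lemma graded_perfect (P : g -> Prop) z : subspace P -> z ^+ m = 1 ->
  (forall r a b, al a = eps ^+ r *: a -> al b = (z / eps ^+ r) *: b -> P (lie a b)) ->
  forall c, al c = z *: c -> P c.
Proof.
move=> sP zm PE c ac.
rewrite -[c]scale1r -[1]/(true%:R) -(eqxx z) -(eigen_proj_eigen zm zm ac).
have sQ : subspace (fun x => P (eigen_proj z x)).
  exact: (@subspace_preim _ _ _ (eigen_proj z) P sP).
move: c {ac}; apply: (simple_perfect sQ) => a b.
move: a; apply: eigen_ind => [|r a ea]; first exact: lie_subspacel sQ.
move: b; apply: eigen_ind => [|s b eb]; first exact: lie_subspacer sQ.
have e := lie_eigen ea eb; rewrite -exprD in e.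
rewrite (eigen_proj_eigen zm (eps_unity _) e); case: eqP => [zE|_].
  rewrite scale1r; apply: (PE r) => //; rewrite zE exprD mulrAC mulfV ?mul1r //.
  by rewrite expf_neq0 ?eps_neq0.
by rewrite scale0r; exact: subspace0.
Qed.

(** Otherwise the algebra would be abelian, as it is spanned by eigenvectors. *)
Lemma nonzero_bracket : exists r s a b,
  [/\ al a = eps ^+ r *: a, al b = eps ^+ s *: b & lie a b <> 0].
Proof.
apply: NNPP => no; have [a [b]] := gs.1; apply.
have s0 : subspace (fun x : g => x = 0) by split=> // s x y -> ->; rewrite scaler0 addr0.
move: a; apply: eigen_ind => [|r a ea]; first exact: lie_subspacel s0.
move: b; apply: eigen_ind => [|s b eb]; first exact: lie_subspacer s0.
by apply: NNPP => nz; apply: no; exists r, s, a, b.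
Qed.
End SimpleGraded.

(** * The filtration of an affine Kac-Moody algebra *)

Section Monomials.
Variables (k : fieldType) (q : nat) (g : 'I_q -> fdLieType k).
Local Notation A := (aff_prod g).

Definition mono_at i (n : int) (c : g i) : A :=
  lprod_mk (dfwith (fun j => 0 : aff (g j)) ((mono n c, 0, 0) : aff (g i))).

Lemma mono_atE i n c : lprod_at (mono_at n c) i = (mono n c, 0, 0) :> aff (g i).
Proof. by rewrite lprodE dfwith_in. Qed.
Lemma mono_at_out i j n (c : g i) : i != j -> lprod_at (mono_at n c) j = 0.
Proof. by move=> ij; rewrite lprodE dfwith_out. Qed.

Lemma mono_at_is_linear i n : linear (@mono_at i n).
Proof.
move=> a x y; apply: lprodP => j; rewrite !lprodE.
case: (eqVneq i j) => [ij|ij]; last by rewrite !dfwith_out // scaler0 addr0.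
case: _ / ij; rewrite !dfwith_in; apply: affP.
- rewrite aff_loopP /aff_loop /=; apply: loopP => p; rewrite loopED loopEZ !monoE.
  by case: eqP => // _; rewrite scaler0 addr0.
- by rewrite aff_cP /aff_c /= mulr0 addr0.
by rewrite aff_dP /aff_d /= mulr0 addr0.
Qed.
HB.instance Definition _ i n :=
  GRing.isLinear.Build k (g i) A *:%R (@mono_at i n) (@mono_at_is_linear i n).

(** The central term occurs only when the degrees are opposite. *)
Lemma lie_mono_at i n p (a b : g i) : n + p != 0 ->
  lie (mono_at n a) (mono_at p b) = mono_at (n + p) (lie a b) :> A.
Proof.
move=> np; apply: lprodP => j; rewrite [LHS]lprodE.
case: (eqVneq i j) => [ij|ij]; last by rewrite !mono_at_out // lie0l.
case: _ / ij; rewrite !mono_atE; apply: affP.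
- by rewrite aff_lie_loop /aff_loop /aff_d /= !scale0r subrr addr0 loop_lie_mono.
- by rewrite aff_lie_c /aff_loop /= cocycle_mono -addr_eq0 (negPf np).
by [].
Qed.

End Monomials.

Section Filtration.
Variables (k : fieldType) (q : nat) (g : 'I_q -> fdLieType k)
    (alpha : forall i, 'End(g i)) (m : 'I_q -> nat) (eps : 'I_q -> k).
Hypothesis epsP : forall i, (m i).-primitive_root (eps i).
Local Notation A := (aff_prod g).
Local Notation L := (kac_moody alpha m eps).
Local Notation Lf := (kac_moody_filt alpha m eps).

Lemma degree_part_subspace n : subspace (@degree_part_eq0 _ _ g n).
Proof.
split=> [i|a x y x0 y0 i]; first by split=> [|_]; rewrite ?lprodE ?loopE0.
have [xl xcd] := x0 i; have [yl ycd] := y0 i; rewrite !lprodE; split.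
  by rewrite aff_loopP loopED loopEZ xl yl scaler0 addr0.
move=> n0; have [xc xd] := xcd n0; have [yc yd] := ycd n0.
by rewrite aff_cP aff_dP xc xd yc yd mulr0 addr0.
Qed.

Lemma filt_subspace j : subspace (Lf j).
Proof.
have sL := kac_moody_subspace alpha m eps.
split=> [|a x y [Lx x0] [Ly y0]].
  by split=> [|n _]; [exact: sL.1|exact: (degree_part_subspace n).1].
split=> [|n nj]; first exact: sL.2.
by apply: (degree_part_subspace n).2; [exact: x0|exact: y0].
Qed.

Lemma filtW i j x : i <= j -> Lf j x -> Lf i x.
Proof. by move=> ij [Lx x0]; split=> // n ni; apply: x0; apply: lt_le_trans ij. Qed.

Lemma mono_at_filt i j n (c : g i) : j <= n -> alpha i c = eps i ^ n *: c ->
  Lf j (mono_at n c : A).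
Proof.
move=> jn ac; split=> [i' p|p pj i'].
  case: (eqVneq i i') => [ii'|ii']; last by rewrite mono_at_out // loopE0 mem0v.
  case: _ / ii'; rewrite mono_atE /aff_loop /= monoE.
  case: eqP => [->|_]; last exact: mem0v.
  exact/(mem_eigenspaceP alpha epsP).
case: (eqVneq i i') => [ii'|ii']; last by rewrite mono_at_out // loopE0.
case: _ / ii'; rewrite mono_atE /aff_loop /aff_c /aff_d /= monoE; split=> //.
by rewrite ifF //; apply: lt_eqF; apply: lt_le_trans jn.
Qed.

Lemma filt_split N x : 0 < N -> Lf N x ->
  Lf (N + 1) (x - \sum_i mono_at N (loop_at (aff_loop (lprod_at x i)) N) : A).
Proof.
move=> N0 [Lx x0]; set y := \sum_i _.
have LfN : Lf N (x - y).
  apply: (subspaceB (filt_subspace N)); first by split.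
  apply: (subspace_sum _ (filt_subspace N)) => i _; apply: mono_at_filt => //.
  exact/(mem_eigenspaceP alpha epsP)/Lx.
split=> [|n nN]; first exact: LfN.1.
have [/LfN.2//|Nn] := ltP n N; have {nN Nn} -> : n = N by lia.
move=> i; split=> [|N0']; last by rewrite N0' in N0.
pose xN j := loop_at (aff_loop (lprod_at x j)) N.
have yE : lprod_at y i = (mono N (xN i), 0, 0) :> aff (g i).
  rewrite /y (bigD1 i) //= [LHS]lprodE mono_atE.
  have -> : lprod_at (\sum_(j | j != i) mono_at N (xN j) : A) i = 0.
    elim/big_ind: _ => [|u v u0 v0|j ji]; last exact: mono_at_out.
      by rewrite lprodE.
    by rewrite lprodE u0 v0 addr0.
  by rewrite addr0.
have -> : lprod_at (x - y) i = lprod_at x i - lprod_at y i by rewrite !lprodE.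
by rewrite yE /aff_loop /= loopED loopEN monoE eqxx subrr.
Qed.

(** The central and the derivation coordinate only count in degree 0. *)
Definition degree_coord i (n : int) (x : A) : (g i * k^o * k^o)%type :=
  (loop_at (aff_loop (lprod_at x i)) n,
   if n == 0 then aff_c (lprod_at x i) else 0,
   if n == 0 then aff_d (lprod_at x i) else 0).

Lemma degree_coord_is_linear i n : linear (degree_coord i n).
Proof.
move=> a x y; rewrite /degree_coord !lprodE aff_loopP loopED loopEZ aff_cP aff_dP.
by congr (_, _, _); case: eqP => //= _; rewrite scaler0 addr0.
Qed.
HB.instance Definition _ i n := GRing.isLinear.Build k A (g i * k^o * k^o)%type *:%R
  (degree_coord i n) (degree_coord_is_linear i n).

Lemma degree_coordP n (x : A) : degree_part_eq0 n x <-> forall i, degree_coord i n x = 0.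
Proof.
split=> [x0 i|x0 i].
  by have [l0 cd0] := x0 i; rewrite /degree_coord l0; case: eqP => // /cd0[-> ->].
have [l0] := x0 i; rewrite l0; case: eqP => [->|n0]; last by split.
by move=> c0 d0.
Qed.

(** The next step of the filtration is cut out by the maps [degree_coord i j], one
    component [i] at a time, each with values in a finite dimensional space. *)
Lemma codim_filt_step j : exists n, codim (Lf j) (Lf (j + 1)) n.
Proof.
pose P (s : seq 'I_q) (x : A) := Lf j x /\ forall i, i \in s -> degree_coord i j x = 0.
have sP s : subspace (P s).
  apply: subspaceI; first exact: filt_subspace.
  split=> [i _|a x y x0 y0 i si]; first exact: linear0.
  by rewrite linearP /= x0 // y0 // scaler0 addr0.
have cP s : exists n, codim (Lf j) (P s) n.
  elim: s => [|i s [n cn]].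
    exists 0%N; apply: codim_ext (codim_refl (filt_subspace j)) => x.
    by split=> [Lx|[]//]; split.
  have [n' cn'] := codim_ker (degree_coord i j) (sP s); exists (n + n')%N.
  apply: codim_trans cn _; [exact: filt_subspace|exact: sP|exact: sP|by move=> x []| |].
    by move=> x [Lx x0]; split=> // i' si'; apply: x0; rewrite inE si' orbT.
  apply: codim_ext cn' => x; split=> [[[Lx x0] xi]|[Lx x0]].
    by split=> // i'; rewrite inE => /orP[/eqP->|/x0].
  split; last by apply: x0; rewrite inE eqxx.
    by split=> // i' si'; apply: x0; rewrite inE si' orbT.
have [n cn] := cP (enum 'I_q); exists n; apply: codim_ext cn => x.
split=> [[[Lx x0] xi]|Lx].
  split=> // p pj; have [/x0//|jp] := ltP p j; have -> : p = j by lia.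
  by apply/degree_coordP => i; apply: xi; rewrite mem_enum.
split=> [|i _]; first by apply: filtW Lx; lia.
by move: i; apply/degree_coordP; apply: Lx.2; lia.
Qed.

Lemma codim_filt i j : i <= j -> exists n, codim (Lf i) (Lf j) n.
Proof.
move=> ij; have -> : j = i + `|j - i|%N%:Z by lia.
elim: `|j - i|%N => [|c [n cn]].
  by exists 0%N; rewrite addr0; apply: codim_refl; exact: filt_subspace.
have [n' cn'] := codim_filt_step (i + c%:Z); exists (n + n')%N.
have -> : i + c.+1%:Z = i + c%:Z + 1 by lia.
apply: codim_trans cn cn'; try exact: filt_subspace.
  by move=> x; apply: filtW; lia.
by move=> x; apply: filtW; lia.
Qed.
End Filtration.

(** * Subalgebras of bounded codimension contain a fixed step *)

Section KacMoodyStable.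
Variables (k : fieldType) (q : nat) (g : 'I_q -> fdLieType k)
    (alpha : forall i, 'End(g i)) (m : 'I_q -> nat) (eps : 'I_q -> k).
Hypotheses (k0 : [pchar k] =i pred0) (gs : forall i, simple_lie (g i))
  (alphaP : forall i, lie_automorphism (alpha i))
  (alpham : forall i, has_order (alpha i) (m i))
  (epsP : forall i, (m i).-primitive_root (eps i)).
Local Notation A := (aff_prod g).
Local Notation L := (kac_moody alpha m eps).
Local Notation Lf := (kac_moody_filt alpha m eps).
Local Notation Fn := (fun j : nat => Lf j%:Z).

Let sLf j : subspace (Lf j) := filt_subspace alpha m eps j.
Let Lf_lie := @kac_moody_filt_lie _ _ _ _ _ _ alphaP epsP.

(** Large enough for [full_degree_pair] with period [m i] and remainder below [m i],
    whatever [i] is; positive so that degree 0, where [c] and [d] live, is excluded. *)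
Definition stable_level n := ((\sum_i m i) * (n.+1 ^ 2).+1).+1.

Lemma filt_sub_subalgebra (K : fieldExtType k) (H : tens A K -> Prop) n n' (j : nat) :
  subspace H -> (forall x y, H x -> H y -> H (lie x y)) ->
  codim (tens_sub (Lf 0)) H n' -> (n' <= n)%N ->
  (forall x, tens_sub (Lf j%:Z) x -> H x) ->
  forall x, tens_sub (Lf (stable_level n)%:Z) x -> H x.
Proof.
move=> sH Hlie cn n'n Fj.
have sF i : subspace (Fn i) by exact: sLf.
have FS i x : Fn i.+1 x -> Fn i x by apply: filtW; lia.
have Flie i i' x y : Fn i x -> Fn i' y -> Fn (i + i')%N (lie x y).
  by rewrite PoszD; exact: Lf_lie.
apply: (full_degrees_sub sH FS _ Fj) => N lN.
have N0 : (0 < N)%N by exact: leq_ltn_trans lN.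
have sfull := full_mod_subspace sF sH N.
rewrite /full_degree; apply: (tens_sub_ind sfull) => x Fx.
rewrite -[x](subrK (\sum_i mono_at N%:Z (loop_at (aff_loop (lprod_at x i)) N%:Z))).
rewrite tens1D tens1_sum; apply: (subspaceD sfull).
  exists (tens1 K (x - \sum_i mono_at N%:Z (loop_at (aff_loop (lprod_at x i)) N%:Z))).
    by apply: tens_sub_tens1 => //; rewrite /= -addn1 PoszD; apply: filt_split.
  by rewrite subrr; exact: subspace0.
apply: (subspace_sum _ sfull) => i _.
have e0 : eps i != 0 := eps_neq0 (epsP i).
have Ex : alpha i (loop_at (aff_loop (lprod_at x i)) N) =
    eps i ^+ N *: loop_at (aff_loop (lprod_at x i)) N.
  by rewrite exprnP; apply/(mem_eigenspaceP alpha epsP); exact: Fx.1.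
have sP : subspace (fun c : g i => full_mod Fn H N (tens1 K (mono_at N%:Z c : A))).
  split=> [|s u v Pu Pv]; first by rewrite linear0 tens1_0; exact: subspace0.
  by rewrite linearP tens1_linear; apply: sfull.2.
move: (loop_at _ _) Ex.
apply: (graded_perfect k0 (gs i) (alphaP i) (alpham i) (epsP i) sP).
  exact: eps_unity (epsP i) N.
move=> r a b ea eb.
have [|t [tN f1 f2]] := full_degree_pair sF sH FS (r := (r %% m i)%N) (N := N)
    cn (prim_order_gt0 (epsP i)).
  apply: leq_trans lN; rewrite /stable_level (bigD1 i) //= mulnDl -addnS.
  apply: leq_trans (leq_addr _ _); rewrite mulnS leq_add //.
    by rewrite ltnW // ltn_mod (prim_order_gt0 (epsP i)).
  by rewrite leq_mul2l leq_sqr ltnS n'n orbT.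
set p := (r %% m i + m i * t)%N in tN f1 f2.
have epsp : eps i ^+ p = eps i ^+ r.
  by rewrite /p exprD exprM (prim_expr_order (epsP i)) expr1n mulr1 prim_expr_mod.
have -> : mono_at N%:Z (lie a b) = lie (mono_at p%:Z a) (mono_at (N - p)%N%:Z b) :> A.
  by rewrite lie_mono_at; [congr (mono_at _ _)|]; lia.
rewrite -tens1_lie -[N in full_mod _ _ N _](subnKC tN).
apply: (full_mod_lie sF FS Flie Hlie f1 f2); apply: tens_sub_tens1 => //.
  by apply: (mono_at_filt epsP) => //; rewrite -exprnP epsp.
apply: (mono_at_filt epsP) => //; rewrite -exprnP eb; congr (_ *: _).
(* the exponent [N - p] represents the residue [N - r] *)
apply: (mulIf (expf_neq0 r e0)); rewrite mulfVK ?expf_neq0 //.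
by rewrite -epsp -exprD subnK.
Qed.
End KacMoodyStable.

(** * Constructibility *)

Lemma pred_ext T (P Q : T -> Prop) : (forall x, P x <-> Q x) -> P = Q.
Proof.
move=> PQ; apply: functional_extensionality => x.
exact: propositional_extensionality.
Qed.

Section PreimageLie.
Variables (k : fieldType) (A : lieType k) (K : fieldExtType k) (U F : A -> Prop).
Variables (N : nat) (b : 'I_N -> A).
Hypotheses (sU : subspace U) (sF : subspace F) (FU : forall x, F x -> U x).
Hypothesis bU : basis_mod U F b.
Hypothesis FF : forall x y, F x -> F y -> F (lie x y).
Variable W : {vspace 'rV[K]_N}.
Local Notation H := (preimage_of F b W).

(** The bracket of two elements expands into brackets of their parts in [F] and of
    lifts of their classes in [W]. *)
Lemma preimage_lie_closed :
  (forall f v, tens_sub F f -> v \in W -> H (lie f (comb b v))) ->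
  (forall u v, u \in W -> v \in W -> H (lie (comb b u) (comb b v))) ->
  forall x y, H x -> H y -> H (lie x y).
Proof.
move=> HF HW x y [u uW Fx] [v vW Fy].
have sH := preimage_subspace b sF W.
rewrite -[x](subrK (comb b u)) -[y](subrK (comb b v)).
move: (x - _) (y - _) Fx Fy => f h Ff Fh; rewrite lieDl !lieDr.
apply: (subspaceD sH); apply: (subspaceD sH).
- by apply: sub_preimage => //; exact: (tens_sub_lie sF FF Ff Fh).
- exact: HF.
- by rewrite lieC; apply: (subspaceN sH); exact: HF.
exact: HW.
Qed.

Lemma preimage_closed (J : Type) (Fj : J -> A -> Prop) j :
  Fj j = F -> closed_sub Fj H.
Proof.
move=> Fjj x /(_ j)[y Fy Hxy]; apply: (preimage_eqmod sF) Hxy.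
by rewrite opprB addrC subrK -Fjj.
Qed.

End PreimageLie.

Section StableN.
Variables (k : fieldType) (A : lieType k) (F : nat -> A -> Prop).
Hypotheses (sF : forall i, subspace (F i)) (F0 : forall i x, F i x -> F 0 x).
Hypothesis F_lie : forall i j x y, F i x -> F j y -> F (i + j) (lie x y).
Hypothesis F_codim : forall i, exists n, codim (F 0) (F i) n.

(** Here [F l] is an ideal of [F 0], so the bracket lives on the quotient. For ideals,
    stability under the basis elements of [F 0] is required in addition. *)
Lemma constructibleN c : constructible_class
  (codim_classN (F 0) (X_class c (F 0) F)) F (fun=> F 0).
Proof.
move=> l n; have [N [b bF]] := F_codim l.
have FF x y : F l x -> F l y -> F l (lie x y).
  by move=> Fx /F0 Fy; have := F_lie Fx Fy; rewrite addn0.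
have F0F x y : F 0 x -> F l y -> F l (lie x y).
  by move=> Fx Fy; exact: F_lie Fx Fy.
have UU x y : F 0 x -> F 0 y -> F 0 (lie x y) by exact: F_lie.
(* brackets of [F 0] stay in [F 0]: no coordinates outside [U = F 0] are needed *)
have [w bw] := codim_refl (sF 0).
pose y i := if c is Ideals then b i else 0.
have yU i x : F 0 x -> F 0 (lie (y i) x).
  rewrite /y; case: (c) => Fx; first by rewrite lie0l; exact: subspace0.
  by apply: UU => //; exact: bF.1.
have [Z ZP] := gr_bracket_conditions (sF 0) (sF 0) (sF l) (F0 (i := l)) bw bF pred0
  (fun d _ => N - d == n)%N yU UU.
exists N, b, Z; split=> // K H.
have bK := tens_basis_mod K (sF 0) (sF l) bF.
have sFK := tens_sub_subspace K (sF l).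
have codW (W : {vspace 'rV[K]_N}) :
    codim (tens_sub (F 0)) (preimage_of (F l) b W) n <-> (N - \dim W == n)%N.
  rewrite -(pred_ext (preimage_fullv (K := K) (sF 0) (sF l) (F0 (i := l)) bF)).
  apply: iff_trans (codim_preimage (sF 0) (sF l) bF fullv W n) _.
  by rewrite capfv dimvf dim_matrix mul1r; split=> [->|/eqP->].
split.
  move=> [[[[sH HU Hlie _ Hid] cH] FH] _].
  have [W WP] := preimageP (sF 0) (sF l) bF sH FH HU.
  exists W => //; rewrite {H WP}(pred_ext WP) in sH HU Hlie Hid cH FH *.
  apply/ZP; split; first exact/codW.
    move=> i v vW; have Hv : preimage_of (F l) b W (comb b v).
      exact/(preimage_comb (sF 0) (sF l) bF).
    move: Hid; rewrite /y; case: (c) => [_|Hid].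
      by rewrite tens1_0 lie0l; exact: subspace0.
    by apply: Hid => //; exact: bK.1.
  by move=> u v uW vW; apply: Hlie; apply/(preimage_comb (sF 0) (sF l) bF).
move=> [W /ZP[excess Hy HW] HE]; rewrite {H HE}(pred_ext HE : H = preimage_of (F l) b W).
have sH := preimage_subspace b (sF l) W.
have HU := preimage_sub (sF 0) (F0 (i := l)) bF (W := W).
have HF f x : tens_sub (F l) f -> tens_sub (F 0) x -> preimage_of (F l) b W (lie f x).
  move=> Ff Fx; apply: sub_preimage; rewrite lieC; apply: (subspaceN sFK).
  exact: tens_sub_lie (sF l) F0F Fx Ff.
have combU (v : 'rV[K]_N) := comb_sub (sF 0) bF v.
have Hlie : forall x y, preimage_of (F l) b W x -> preimage_of (F l) b W y ->
    preimage_of (F l) b W (lie x y).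
  by apply: preimage_lie_closed => // f v Ff vW; apply: HF.
split; last exact: HU.
split; last by move=> x Fx; exact: sub_preimage.
split; last exact/codW.
split=> //; first exact: (@preimage_closed _ _ _ _ _ _ (sF l) W _ F l).
move: Hy; rewrite /y; case: (c) => // Hy x z Ux [v vW Fz].
have [u Fu] := comb_surj (sF 0) (sF l) bF Ux.
rewrite -[z](subrK (comb b v)) lieDr; apply: (subspaceD sH).
  by apply: sub_preimage; exact: tens_sub_lie (sF l) F0F Ux Fz.
rewrite -[x](subrK (comb b u)) lieDl; apply: (subspaceD sH); first exact: HF.
rewrite {1}/comb lie_suml; apply: (subspace_sum _ sH) => i _.
by rewrite lieZl; apply: (subspaceZ _ sH); apply: Hy.
Qed.
End StableN.

(** The basis of [U] modulo [F] is adapted to the intermediate subspace [P], which thus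
    becomes a coordinate subspace. *)
Section CoordinatePreimage.
Variables (k : fieldType) (A : lieType k) (U P F : A -> Prop).
Variables (N1 N2 : nat) (u : 'I_N1 -> A) (w : 'I_N2 -> A).
Hypotheses (sU : subspace U) (sP : subspace P) (sF : subspace F).
Hypotheses (PU : forall x, P x -> U x) (FP : forall x, F x -> P x).
Hypotheses (bu : basis_mod U P u) (bw : basis_mod P F w).

Definition cat_basis (i : 'I_(N1 + N2)) : A :=
  match split i with inl i => u i | inr i => w i end.
Definition left_coord (i : 'I_(N1 + N2)) : bool := (i < N1)%N.

Lemma comb_cat (K : fieldExtType k) (v : 'rV[K]_(N1 + N2)) :
  comb cat_basis v = comb u (lsubmx v) + comb w (rsubmx v).
Proof.
rewrite /comb big_split_ord; congr (_ + _); apply: eq_bigr => i _; rewrite mxE /cat_basis.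
  by rewrite -[lshift N2 i]/(unsplit (inl i)) unsplitK.
by rewrite -[rshift N1 i]/(unsplit (inr i)) unsplitK.
Qed.

Lemma coord_space_lsubmx (K : fieldExtType k) (v : 'rV[K]_(N1 + N2)) :
  v \in coord_space K left_coord <-> lsubmx v = 0.
Proof.
split=> [/coord_spaceP v0|v0].
  by apply/rowP => i; rewrite !mxE v0 // /left_coord /=.
apply/coord_spaceP => i lti; have -> : i = lshift N2 (Ordinal lti) by apply: val_inj.
by have /rowP/(_ (Ordinal lti)) := v0; rewrite !mxE.
Qed.

Lemma preimage_coord_space (K : fieldExtType k) (x : tens A K) :
  preimage_of F cat_basis (coord_space K left_coord) x <-> tens_sub P x.
Proof.
have sPK := tens_sub_subspace K sP; split=> [[v /coord_space_lsubmx v0 Fx]|Px].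
  apply: (subspace_eqmod sPK (y := comb cat_basis v)); first exact: tens_subS Fx.
  by rewrite comb_cat v0 linear0 add0r; exact: comb_sub sP bw _.
have [v Fx] := comb_surj sP sF bw Px.
exists (row_mx 0 v); first by apply/coord_space_lsubmx; rewrite row_mxKl.
by rewrite comb_cat row_mxKl row_mxKr linear0 add0r.
Qed.

Lemma dim_left_coord (K : fieldExtType k) : \dim (coord_space K left_coord) = N2.
Proof.
rewrite dim_coord_space -sum1_card big_split_ord /= big1 => [|i].
  rewrite add0n (eq_bigl predT) ?sum1_card ?card_ord // => i.
  by rewrite inE /left_coord /= -leqNgt leq_addr.
by rewrite inE /left_coord /= ltn_ord.
Qed.
End CoordinatePreimage.

Section StableZ.
Variables (k : fieldType) (A : lieType k) (L : A -> Prop) (F : int -> A -> Prop).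
Hypothesis sF : forall i, subspace (F i).
Hypothesis F_le : forall i j x, i <= j -> F j x -> F i x.
Hypothesis (FL : forall i x, F i x -> L x).
Hypothesis F_lie : forall i j x y, F i x -> F j y -> F (i + j) (lie x y).
Hypothesis F_codim : forall i j, i <= j -> exists n, codim (F i) (F j) n.

(** Brackets of F_{-l} with itself only lie in F_{-2l}, and F_l need not be stable under
    brackets with F_{-l}. Since F_{2l} maps F_{-l} into F_l, it is enough to test on
    lifts of [W] and on a basis [y] of F_l modulo F_{2l}. The hypothesis on ideals means
    that the algebra is zero; it makes the ideal condition void. *)
Lemma constructibleZ c : (c = Ideals -> forall x y : A, x = y) -> constructible_class
  (codim_classZ F (X0_class c L F)) (fun l => F l%:Z) (fun l => F (- l%:Z)).
Proof.
move=> triv l n.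
have [|N1 [u bu]] := @F_codim (- l%:Z) 0; first by lia.
have [|N2 [w bw]] := @F_codim 0 l%:Z; first by lia.
have [|N' [b' bb']] := @F_codim (- l%:Z - l%:Z) (- l%:Z); first by lia.
have [|s [y bY]] := @F_codim l%:Z (l%:Z + l%:Z); first by lia.
pose U := F (- l%:Z); pose V := F (- l%:Z - l%:Z).
have FU x : F l%:Z x -> U x by apply: F_le; lia.
have PU x : F 0 x -> U x by apply: F_le; lia.
have FP x : F l%:Z x -> F 0 x by apply: F_le; lia.
have F'F x : F (l%:Z + l%:Z) x -> F l%:Z x by apply: F_le; lia.
pose b := cat_basis u w.
have bU : basis_mod U (F l%:Z) b := basis_mod_cat (sF _) (sF _) (sF _) PU FP bu bw.
have FF x z : F l%:Z x -> F l%:Z z -> F l%:Z (lie x z).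
  by move=> Fx Fz; apply: F'F; exact: F_lie.
have F'U x z : F (l%:Z + l%:Z) x -> U z -> F l%:Z (lie x z).
  by move=> Fx Uz; have := F_lie Fx Uz; rewrite addrK.
have yU i x : U x -> V (lie (y i) x).
  by move=> Ux; have := F_lie (bY.1 i) Ux; apply: F_le; lia.
have UU x z : U x -> U z -> V (lie x z) by exact: F_lie.
have [Z ZP] := gr_bracket_conditions (sF _) (sF _) (sF _) FU bb' bU (@left_coord N1 N2)
  (fun d r => n == (d - r) + (N2 - r))%N yU UU.
exists (N1 + N2)%N, b, Z; split=> // K H.
have sFK := tens_sub_subspace K (sF l%:Z).
have PE (x : tens A K) := preimage_coord_space u (sF 0) (sF l%:Z) FP bw x.
pose cap (W : {vspace 'rV[K]_(N1 + N2)}) :=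
  (W :&: coord_space K (@left_coord N1 N2))%VS.
pose excess (W : {vspace 'rV[K]_(N1 + N2)}) := (\dim W - \dim (cap W))%N.
pose defect (W : {vspace 'rV[K]_(N1 + N2)}) := (N2 - \dim (cap W))%N.
have codW (W : {vspace 'rV[K]_(N1 + N2)}) (p r : nat) :
    codim (preimage_of (F l%:Z) b W) (tens_sub (F 0)) p /\
    codim (tens_sub (F 0)) (preimage_of (F l%:Z) b W) r <->
    p = excess W /\ r = defect W.
  rewrite -(pred_ext PE); have c1 := codim_preimage (sF _) (sF _) bU.
  split=> [[/c1 -> /c1 ->]|[-> ->]].
    by rewrite [(coord_space _ _ :&: _)%VS]capvC dim_left_coord.
  by split; apply/c1; rewrite // [(coord_space _ _ :&: _)%VS]capvC dim_left_coord.
have relW (W : {vspace 'rV[K]_(N1 + N2)}) :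
    rel_codim (tens_sub (F 0)) (preimage_of (F l%:Z) b W) n <->
    n == (excess W + defect W)%N.
  split=> [[p [r [c1 c2 ->]]]|/eqP->].
    by have [-> ->] := (codW W p r).1 (conj c1 c2).
  by have [c1 c2] := (codW W _ _).2 (conj erefl erefl); exists (excess W), (defect W).
split.
  move=> [[[[[sH _ Hlie _ _] _] cH] FH] HU].
  have [W WP] := preimageP (sF _) (sF _) bU sH FH HU.
  exists W => //; rewrite {H WP}(pred_ext WP) in sH HU Hlie cH FH *.
  apply/ZP; split; first exact/relW.
    move=> i v vW; apply: Hlie; last exact/(preimage_comb (sF _) (sF _) bU).
    by apply: FH; apply: tens_sub_tens1; [exact: sF|exact: bY.1].
  by move=> z v zW vW; apply: Hlie; apply/(preimage_comb (sF _) (sF _) bU).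
move=> [W /ZP[RW Hy HW] HE]; rewrite {H HE}(pred_ext HE : H = preimage_of (F l%:Z) b W).
have sH := preimage_subspace b (sF l%:Z) W.
have HU := preimage_sub (sF _) FU bU (W := W).
have Hlie : forall x z, preimage_of (F l%:Z) b W x -> preimage_of (F l%:Z) b W z ->
    preimage_of (F l%:Z) b W (lie x z).
  apply: preimage_lie_closed => // f v Ff vW.
  have [a Fa] := comb_surj (sF _) (sF _) bY Ff.
  rewrite -[f](subrK (comb y a)) lieDl; apply: (subspaceD sH).
    apply: sub_preimage; apply: (tens_sub_lie (sF _) F'U Fa).
    exact: comb_sub (sF _) bU _.
  rewrite {1}/comb lie_suml; apply: (subspace_sum _ sH) => i _.
  by rewrite lieZl; apply: (subspaceZ _ sH); apply: Hy.
split; last exact: HU.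
split; last by move=> x Fx; exact: sub_preimage.
split; last exact/relW.
split.
  split=> //.
  - by move=> x /HU; apply: tens_subS => z; exact: FL.
  - exact: (@preimage_closed _ _ _ _ _ _ (sF _) W _ F l%:Z).
  case: (c) triv => // /(_ erefl) triv x z _ _.
  suff -> : lie x z = 0 by exact: subspace0.
  by apply/ffunP => i; exact: triv.
have [c1 c2] := (codW W _ _).2 (conj erefl erefl).
by split; [exists (excess W)|exists (defect W)].
Qed.

End StableZ.

(** * Ideals between two steps of the filtration *)

Section KacMoodyIdeals.
Variables (k : fieldType) (q : nat) (g : 'I_q -> fdLieType k)
    (alpha : forall i, 'End(g i)) (m : 'I_q -> nat) (eps : 'I_q -> k).
Hypotheses (k0 : [pchar k] =i pred0) (gs : forall i, simple_lie (g i))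
  (alpham : forall i, has_order (alpha i) (m i))
  (epsP : forall i, (m i).-primitive_root (eps i)).
Local Notation A := (aff_prod g).
Local Notation L := (kac_moody alpha m eps).
Local Notation Lf := (kac_moody_filt alpha m eps).

(** Multiply an element of [H] of degree [p >= l] by one of very negative degree [n],
    with residues chosen so that the bracket is not zero. *)
Lemma no_bounded_ideal (i : 'I_q) (l : nat) (K : fieldExtType k) (H : tens A K -> Prop) :
  (forall x y, tens_sub L x -> H y -> H (lie x y)) ->
  (forall x, tens_sub (Lf l%:Z) x -> H x) ->
  ~ (forall x, H x -> tens_sub (Lf (- l%:Z)) x).
Proof.
move=> Hid FH HF.
have [r [s [a [b [ea eb]]]]] :=
  nonzero_bracket k0 (gs i) (alpham i) (epsP i).
apply; have m0 := prim_order_gt0 (epsP i).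
have e0 : eps i != 0 := eps_neq0 (epsP i).
have epsm (n : int) : eps i ^ ((m i)%:Z * n) = 1.
  by rewrite -exprz_exp -exprnP (prim_expr_order (epsP i)) exp1rz.
pose p := r%:Z + (m i)%:Z * l%:Z.
(* [n] is congruent to [s] modulo [m i], and [n + p < - l] *)
pose n := s%:Z + (m i)%:Z * (- (2 * l + r + s + 1)%N%:Z).
have pl : l%:Z <= p by rewrite /p; nia.
have np : n + p < - l%:Z by rewrite /n /p; nia.
have Fx : Lf l%:Z (mono_at p a : A).
  by apply: (mono_at_filt epsP) => //; rewrite /p expfzDr // epsm mulr1.
have Fy : Lf n (mono_at n b : A).
  by apply: (mono_at_filt epsP) => //; rewrite /n expfzDr // epsm mulr1.
have sL := kac_moody_subspace alpha m eps.
have sF := filt_subspace alpha m eps.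
have Hxy := Hid _ _ (tens_sub_tens1 sL Fy.1) (FH _ (tens_sub_tens1 (sF _) Fx)).
have np0 : n + p != 0 by lia.
have [_ /(_ _ np i)[]] : Lf (- l%:Z) (mono_at (n + p) (lie b a) : A).
  rewrite -lie_mono_at //; apply: (@tens_sub_tens1_inv _ _ K); first exact: filt_subspace.
  by rewrite -tens1_lie; apply: HF.
by rewrite mono_atE /aff_loop /= monoE eqxx lieC => /eqP; rewrite oppr_eq0 => /eqP.
Qed.
End KacMoodyIdeals.

(** * The theorem *)

Theorem theorem2p26 (k : fieldType) (q : nat) (g : 'I_q -> fdLieType k)
    (alpha : forall i, 'End(g i)) (m : 'I_q -> nat) (eps : 'I_q -> k)
    (L := kac_moody alpha m eps) (Lfilt := kac_moody_filt alpha m eps) :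
  [pchar k] =i pred0 ->
  (forall i, simple_lie (g i)) ->
  (forall i, lie_automorphism (alpha i)) ->
  (forall i, has_order (alpha i) (m i)) ->
  (forall i, (m i).-primitive_root (eps i)) ->
  no_infdim_abelian_quotient L ->
  forall c : class_kind,
    stableN (Lfilt 0) (fun j : nat => Lfilt j%:Z)
      (X_class c (Lfilt 0) (fun j : nat => Lfilt j%:Z)) /\
    stableZ Lfilt (X0_class c L Lfilt).
Proof.
move=> k0 gs alphaP alpham epsP _ c.
have sF j : subspace (Lfilt j) := filt_subspace alpha m eps j.
have F_le i j x : i <= j -> Lfilt j x -> Lfilt i x by exact: filtW.
have F_lie := @kac_moody_filt_lie _ _ _ _ _ _ alphaP epsP.
have F_codim i j : i <= j -> exists n, codim (Lfilt i) (Lfilt j) n by exact: codim_filt.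
split; split.
- apply: constructibleN => [i|i x|i j x y|i]; first exact: sF.
  + by apply: F_le.
  + by rewrite PoszD; exact: F_lie.
  by apply: F_codim.
- move=> n; exists (stable_level m n) => j lj K H; split=> [][Hn FH]; split=> //.
    by move=> x Fx; apply: FH; apply: tens_subS Fx => y; apply: F_le; lia.
  have [[sH _ Hlie _ _] cH] := Hn.
  exact: (filt_sub_subalgebra k0 gs alphaP alpham epsP sH Hlie cH (leqnn n) FH).
- have [/(_ _)triv|] := classic (c = Ideals -> forall x y : aff_prod g, x = y).
    by apply: constructibleZ => // i x [].
  move=> ntriv l n.
  have [cI nt] := imply_to_and _ _ ntriv.
  have [i] : exists i : 'I_q, True.
    apply: NNPP => noi; apply: nt => x y; apply: lprodP => i; case: noi; by exists i.
  move=> _; have [|N [b bF]] := @F_codim (- l%:Z) l%:Z; first by lia.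
  have [Z ZP] := gr_empty k N; exists N, b, Z; split=> // K H; split.
    move=> [[[[[_ _ _ _ Hid] _] _] FH] HU]; rewrite cI in Hid.
    by case: (no_bounded_ideal k0 gs alpham epsP i Hid FH HU).
  by case=> W HW; case/negP: (ZP K W).
move=> n; exists (stable_level m n) => j lj K H; split=> [][Hn FH]; split=> //.
  by move=> x Fx; apply: FH; apply: tens_subS Fx => y; apply: F_le; lia.
have [[[sH _ Hlie _ _] _] [p [r [_ cH nE]]]] := Hn.
apply: (filt_sub_subalgebra k0 gs alphaP alpham epsP sH Hlie cH _ FH).
by rewrite nE leq_addl.
Qed.
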